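(* Let $R$ be a semiprime left Goldie ring and let $A=R[x_1;\sigma_1]\cdots[x_n;\sigma_n]$ be a quasi-commutative skew PBW extension of $R$. Then $A$ is semiprime left Goldie; hence $Q_l(A)$ exists and is semisimple. If $R$ is semiprime right Goldie and every $\sigma_i$ is bijective, then $A$ is semiprime right Goldie; hence $Q_r(A)$ exists and is semisimple.
   Context: Rings are associative with identity. Quasi-commutative skew PBW extension. A ring $A\supseteq R$ is a quasi-commutative skew PBW extension of $R$ if: - there are $x_1,\dots,x_n\in A$ such that $A$ is a free left $R$-module with basis $\{x_1^{\alpha_1}\cdots x_n^{\alpha_n}:\alpha\in\mathbb N^n\}$; - for each $i$ and $r\in R\setminus\{0\}$ there is $c_{i,r}\in R\setminus\{0\}$ with $x_ir=c_{i,r}x_i$; - for all $i,j$ there is $c_{i,j}\in R\setminus\{0\}$ with $x_jx_i=c_{i,j}x_ix_j$. Such an $A$ is identified with an iterated skew polynomial ring of endomorphism type $R[x_1;\sigma_1]\cdots[x_n;\sigma_n]$. Each $\sigma_i$ is an injective endomorphism of $R[x_1;\sigma_1]\cdots[x_{i-1};\sigma_{i-1}]$, and $x_ib=\sigma_i(b)x_i$ for $b$ in that ring. $Q_l(A)$ (respectively $Q_r(A)$) denotes the left (respectively right) total ring of fractions, i.e. the classical left (right) ring of fractions with respect to all regular elements. *)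

(* Defs.v *)
From HB Require Import structures.
From mathcomp Require Import all_boot all_order all_algebra.
Set Implicit Arguments. Unset Strict Implicit. Unset Printing Implicit Defensive.
Import GRing.Theory.
Local Open Scope ring_scope.

Definition is_left_ideal (R : nzRingType) (I : R -> Prop) : Prop :=
  [/\ I 0, (forall a b, I a -> I b -> I (a + b)) & (forall r a, I a -> I (r * a))].

Definition is_right_ideal (R : nzRingType) (I : R -> Prop) : Prop :=
  [/\ I 0, (forall a b, I a -> I b -> I (a + b)) & (forall r a, I a -> I (a * r))].

Definition is_ideal (R : nzRingType) (I : R -> Prop) : Prop :=
  is_left_ideal I /\ is_right_ideal I.

(* Semiprime (Lam): the zero ideal is semiprime, i.e. every two-sided ideal
   J with J^2 = 0 is zero (J^2 = 0 iff all products of two elements vanish). *)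
Definition semiprime (R : nzRingType) : Prop :=
  forall J : R -> Prop, is_ideal J ->
    (forall a b, J a -> J b -> a * b = 0) -> forall a, J a -> a = 0.

Definition lann (R : nzRingType) (S : R -> Prop) : R -> Prop :=
  fun r => forall s, S s -> r * s = 0.
Definition rann (R : nzRingType) (S : R -> Prop) : R -> Prop :=
  fun r => forall s, S s -> s * r = 0.

Definition acc_lann (R : nzRingType) : Prop :=
  forall f : nat -> R -> Prop,
    (forall k, exists S : R -> Prop, forall r, f k r <-> lann S r) ->
    (forall k r, f k r -> f k.+1 r) ->
    exists N, forall k, (N <= k)%N -> forall r, f k r -> f N r.
Definition acc_rann (R : nzRingType) : Prop :=
  forall f : nat -> R -> Prop,
    (forall k, exists S : R -> Prop, forall r, f k r <-> rann S r) ->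
    (forall k r, f k r -> f k.+1 r) ->
    exists N, forall k, (N <= k)%N -> forall r, f k r -> f N r.

Definition independent (R : nzRingType) (I : nat -> R -> Prop) : Prop :=
  forall (m : nat) (a : nat -> R),
    (forall i, (i < m)%N -> I i (a i)) ->
    \sum_(i < m) a i = 0 -> forall i, (i < m)%N -> a i = 0.

Definition finite_left_udim (R : nzRingType) : Prop :=
  ~ exists I : nat -> R -> Prop,
      [/\ forall k, is_left_ideal (I k),
          forall k, exists a, I k a /\ a <> 0 & independent I].
Definition finite_right_udim (R : nzRingType) : Prop :=
  ~ exists I : nat -> R -> Prop,
      [/\ forall k, is_right_ideal (I k),
          forall k, exists a, I k a /\ a <> 0 & independent I].

Definition left_Goldie (R : nzRingType) : Prop := acc_lann R /\ finite_left_udim R.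
Definition right_Goldie (R : nzRingType) : Prop := acc_rann R /\ finite_right_udim R.

Definition regular (R : nzRingType) (s : R) : Prop :=
  (forall a, s * a = 0 -> a = 0) /\ (forall a, a * s = 0 -> a = 0).

Definition invertible (Q : nzRingType) (q : Q) : Prop :=
  exists t, q * t = 1 /\ t * q = 1.

Definition is_left_total_quotient (A Q : nzRingType) (phi : {rmorphism A -> Q}) : Prop :=
  [/\ injective phi,
      (forall s, regular s -> invertible (phi s)) &
      (forall q, exists s a, regular s /\ phi s * q = phi a)].
Definition is_right_total_quotient (A Q : nzRingType) (phi : {rmorphism A -> Q}) : Prop :=
  [/\ injective phi,
      (forall s, regular s -> invertible (phi s)) &
      (forall q, exists s a, regular s /\ q * phi s = phi a)].

Definition semisimple (Q : nzRingType) : Prop :=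
  forall L : Q -> Prop, is_left_ideal L ->
    exists L' : Q -> Prop,
      [/\ is_left_ideal L',
          (forall q, exists a b, [/\ L a, L' b & q = a + b]) &
          (forall q, L q -> L' q -> q = 0)].

Definition Ql_exists_semisimple (A : nzRingType) : Prop :=
  exists (Q : nzRingType) (phi : {rmorphism A -> Q}),
    is_left_total_quotient phi /\ semisimple Q.
Definition Qr_exists_semisimple (A : nzRingType) : Prop :=
  exists (Q : nzRingType) (phi : {rmorphism A -> Q}),
    is_right_total_quotient phi /\ semisimple Q.

Definition monom (A : nzRingType) (n : nat) (x : 'I_n -> A) (al : {ffun 'I_n -> nat}) : A :=
  \prod_(i < n) x i ^+ al i.

Definition quasi_comm_skew_PBW (R A : nzRingType) (iota : {rmorphism R -> A})
    (n : nat) (x : 'I_n -> A) : Prop :=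
  [/\ injective iota,
      (forall a : A, exists (s : seq {ffun 'I_n -> nat}) (c : {ffun 'I_n -> nat} -> R),
          a = \sum_(al <- s) iota (c al) * monom x al),
      (forall (s : seq {ffun 'I_n -> nat}) (c : {ffun 'I_n -> nat} -> R),
          uniq s -> \sum_(al <- s) iota (c al) * monom x al = 0 ->
          forall al, al \in s -> c al = 0),
      (forall (i : 'I_n) (r : R), r != 0 ->
          exists c : R, c != 0 /\ x i * iota r = iota c * x i) &
      (forall i j : 'I_n, exists c : R, c != 0 /\ x j * x i = iota c * x i * x j)].

(* Elements of the intermediate ring R[x_1;s_1]...[x_{i-1};s_{i-1}] (indices < i
   with 0-based indexing), i.e. left R-combinations of monomials in x_j, j < i. *)
Definition in_lower (R A : nzRingType) (iota : {rmorphism R -> A})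
    (n : nat) (x : 'I_n -> A) (i : 'I_n) (b : A) : Prop :=
  exists (s : seq {ffun 'I_n -> nat}) (c : {ffun 'I_n -> nat} -> R),
    (forall al, al \in s -> forall j : 'I_n, (i <= j)%N -> al j = 0) /\
    b = \sum_(al <- s) iota (c al) * monom x al.

(* sigma_i is the endomorphism of the lower ring determined by x_i b = sigma_i(b) x_i.
   "Every sigma_i is bijective": the relation {(b, b') | x_i b = b' x_i} on the lower
   ring is the graph of a bijection of the lower ring onto itself. *)
Definition all_sigma_bijective (R A : nzRingType) (iota : {rmorphism R -> A})
    (n : nat) (x : 'I_n -> A) : Prop :=
  forall i : 'I_n,
    (forall b, in_lower iota x i b ->
       exists b', [/\ in_lower iota x i b', x i * b = b' * x i &
                   forall b'', in_lower iota x i b'' -> x i * b = b'' * x i -> b'' = b']) /\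
    (forall b', in_lower iota x i b' ->
       exists b, [/\ in_lower iota x i b, x i * b = b' * x i &
                  forall b'', in_lower iota x i b'' -> x i * b'' = b' * x i -> b'' = b]).

(* Main.v *)
Require Import Defs.
From HB Require Import structures.
From mathcomp Require Import all_boot all_order all_algebra.
From mathcomp Require Import generic_quotient boolp classical_sets.
Set Implicit Arguments. Unset Strict Implicit. Unset Printing Implicit Defensive.
Import GRing.Theory.
Local Open Scope ring_scope.

(* Adjoining the variables one at a time reduces the claim to a single Ore extension
   A = R[x; sigma] with sigma injective.  In a semiprime left Goldie ring R, maximal
   "triangular" families of uniform elements (Goldie's construction of regular elements)
   have as many members as the uniform dimension, so sigma maps them to families of the
   same kind; hence sigma preserves regular elements, and every essential left ideal of
   A contains a polynomial with regular leading coefficient.  Such a polynomial g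
   generates an essential left ideal: by division, A/Ag is controlled by finitely many
   copies of R, whereas A f has infinite rank over R for every f <> 0.  This yields that
   A is semiprime, nonsingular and of finite uniform dimension.  The quotient ring is
   realized as germs of left linear maps defined on essential left ideals.  The
   right-hand version follows by passing to the converse rings, where a bijective
   sigma is replaced by its inverse. *)

(** * Spans and independent families in modules *)

(** The obstacle is that [sigma] is only injective: its image may be small in [R], so neither
    essential left ideals nor regular elements can be read off from it. Only two things are
    therefore transported along [sigma]: equations such as [x * b = 0], and the length of a family.
    Square-regularity of the images, a condition that quantifies over all of [R], is recovered by
    passing to a power given by the uniform dimension; a triangular family of full length then has
    an essential span. The induction removes the variable next to the base: [A] stays fixed while
    [R] is replaced by [R[x_1]], over which the remaining variables must again form a
    quasi-commutative extension. Dedekind finiteness of [R] enters at this point. With germs of maps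
    the ring axioms hold pointwise, without a calculus of fractions. Semisimplicity is formulated
    with left ideals, so the right-hand statement also rests on its left-right symmetry. *)

Lemma greedy_sequence (T : Type) (Inv : seq T -> Prop) :
  Inv [::] -> (forall l, Inv l -> exists a, Inv (rcons l a)) ->
  exists u : nat -> T, forall m, Inv (mkseq u m).
Proof.
move=> Inv0 InvS.
have [a0 _] := InvS _ Inv0.
have /choice[nxt nxtP] : forall l, exists a, Inv l -> Inv (rcons l a).
  by move=> l; have [/InvS[a Ha]|nI] := pselect (Inv l); [exists a|exists a0].
pose L := fix L k := if k is k'.+1 then rcons (L k') (nxt (L k')) else [::].
exists (fun k => nxt (L k)) => m.
suff -> : mkseq (fun k => nxt (L k)) m = L m by elim: m => //= m /nxtP.
by elim: m => //= m IH; rewrite mkseqS IH.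
Qed.

Lemma mkseqD (T : Type) (u : nat -> T) (k m : nat) :
  mkseq u (k + m)%N = mkseq u k ++ mkseq (fun i => u (k + i)%N) m.
Proof. by rewrite /mkseq iotaD add0n map_cat -[in iota k m](addn0 k) iotaDl -map_comp. Qed.

Section Span.
Variables (R : nzRingType) (V : lmodType R).
Implicit Types (l : seq V) (a x y : V) (r : R).

Fixpoint in_span l x : Prop :=
  if l is a :: l' then exists r, in_span l' (x - r *: a) else x = 0.

Lemma in_span0 l : in_span l 0.
Proof. by elim: l => //= a l IH; exists 0; rewrite scale0r subr0. Qed.

Lemma in_spanD l x y : in_span l x -> in_span l y -> in_span l (x + y).
Proof.
elim: l x y => [|a l IH] x y /=; first by move=> -> ->; rewrite addr0.
by case=> r Hx [s Hy]; exists (r + s); rewrite scalerDl opprD addrACA; apply: IH.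
Qed.

Lemma in_spanZ l r x : in_span l x -> in_span l (r *: x).
Proof.
elim: l x => [|a l IH] x /=; first by move=> ->; rewrite scaler0.
by case=> s Hx; exists (r * s); rewrite -scalerA -scalerBr; apply: IH.
Qed.

Lemma in_spanN l x : in_span l x -> in_span l (- x).
Proof. by rewrite -scaleN1r; apply: in_spanZ. Qed.

Lemma in_spanB l x y : in_span l x -> in_span l y -> in_span l (x - y).
Proof. by move=> Hx Hy; apply: in_spanD Hx (in_spanN Hy). Qed.

Lemma in_spanBK l y x : in_span l y -> in_span l (y - x) -> in_span l x.
Proof. by move=> Hy /in_spanN; rewrite opprB => /(in_spanD Hy); rewrite addrC subrK. Qed.

Lemma in_span_cons l a x : in_span l x -> in_span (a :: l) x.
Proof. by exists 0; rewrite scale0r subr0. Qed.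

Lemma in_span_head l a r : in_span (a :: l) (r *: a).
Proof. by exists r; rewrite subrr; apply: in_span0. Qed.

Lemma in_span_mem l a : a \in l -> in_span l a.
Proof.
elim: l => //= b l IH; rewrite inE => /orP[/eqP ->|/IH]; last exact: in_span_cons.
by have := in_span_head l b 1; rewrite scale1r.
Qed.

Lemma in_span_least (W : V -> Prop) l x : W 0 ->
  (forall u v, W u -> W v -> W (u + v)) -> (forall r u, W u -> W (r *: u)) ->
  (forall a, a \in l -> W a) -> in_span l x -> W x.
Proof.
move=> W0 WD WZ; elim: l x => [|a l IH] x /= Wl; first by move->.
case=> r /IH Hx; rewrite -[x](subrK (r *: a)); apply: WD; last first.
  by apply/WZ/Wl; rewrite mem_head.
by apply: Hx => b Hb; apply: Wl; rewrite inE Hb orbT.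
Qed.

Lemma in_span_sub l1 l2 x : {subset l1 <= l2} -> in_span l1 x -> in_span l2 x.
Proof.
move=> sub; apply: in_span_least; [exact: in_span0|exact: in_spanD|exact: in_spanZ|].
by move=> a /sub; apply: in_span_mem.
Qed.

Lemma in_span_rcons l a x : in_span (rcons l a) x -> exists r, in_span l (x - r *: a).
Proof.
elim: l x => [|b l IH] x /=; first by [].
by case=> r /IH[s Hs]; exists s, r; rewrite addrAC.
Qed.

(** This says that the sum of the cyclic submodules generated by [l] is direct and that the
    generators are nonzero. The conclusion is [r *: a = 0] rather than [r = 0], because a member may
    have a nonzero annihilator. *)
Fixpoint indep l : Prop :=
  if l is a :: l' then
    [/\ a <> 0, forall r, in_span l' (r *: a) -> r *: a = 0 & indep l']
  else True.

Lemma indep_rcons l a : indep (rcons l a) <->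
  [/\ indep l, a <> 0 & forall r, in_span l (r *: a) -> r *: a = 0].
Proof.
elim: l => [|b l IH] /=; first by split=> -[].
split.
  case=> b0 Hb /IH[il a0 Ha]; split=> //.
    split=> // r Hr; apply: Hb; apply: in_span_sub Hr.
    by move=> y; rewrite mem_rcons inE orbC => ->.
  move=> r [s Hs]; have sb0 : s *: b = 0.
    apply: Hb; apply: (@in_spanBK _ (r *: a)).
      by apply/in_spanZ/in_span_mem; rewrite mem_rcons mem_head.
    by apply: in_span_sub Hs => y; rewrite mem_rcons inE orbC => ->.
  by apply: Ha; rewrite sb0 subr0 in Hs.
case=> -[b0 Hb il] a0 Ha; split=> //; last first.
  by apply/IH; split=> // r Hr; apply/Ha/in_span_cons.
move=> r /in_span_rcons[s Hs]; apply: Hb.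
suff sa0 : s *: a = 0 by rewrite sa0 subr0 in Hs.
apply: Ha; apply: (@in_spanBK (b :: l) (r *: b)); first exact: in_span_head.
exact: in_span_cons.
Qed.

Lemma indep_cat l1 l2 : indep (l1 ++ l2) ->
  indep l2 /\ forall y, in_span l1 y -> in_span l2 y -> y = 0.
Proof.
elim: l1 => [|a l1 IH] //= [a0 Ha /IH[i2 H]]; split=> // y [r Hr] Hy.
suff ra0 : r *: a = 0 by apply: H => //; rewrite ra0 subr0 in Hr.
apply: Ha; apply: (@in_spanBK _ y).
  by apply: in_span_sub Hy => z; rewrite mem_cat orbC => ->.
by apply: in_span_sub Hr => z; rewrite mem_cat => ->.
Qed.

Lemma indep_neq0 l a : indep l -> a \in l -> a <> 0.
Proof.
by elim: l => //= b l IH [b0 _ il]; rewrite inE => /orP[/eqP ->|/IH]; last exact.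
Qed.

Lemma indep_uniq l : indep l -> uniq l.
Proof.
elim: l => //= a l IH [a0 Ha /IH ->]; rewrite andbT; apply/negP => al.
by apply: a0; rewrite -[a]scale1r; apply/Ha/in_spanZ/in_span_mem.
Qed.

Lemma indep_multiples (T : eqType) (s : seq T) (g : T -> V) (c : T -> R) :
  (forall t, t \in s -> c t *: g t <> 0) -> indep [seq g t | t <- s] ->
  indep [seq c t *: g t | t <- s].
Proof.
elim: s => //= t s IH nz [g0 Hg ig]; split; first by apply: nz; rewrite mem_head.
  move=> r; rewrite scalerA => Hr; apply: Hg; move: Hr.
  apply: in_span_least; [exact: in_span0|exact: in_spanD|exact: in_spanZ|].
  by move=> _ /mapP[u us ->]; apply/in_spanZ/in_span_mem/map_f.
by apply: IH => // u us; apply: nz; rewrite inE us orbT.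
Qed.

Definition no_infinite_indep (P : V -> Prop) : Prop :=
  ~ exists u : nat -> V, forall m, P (u m) /\ indep (mkseq u m).

(** Source of the finite maximal families: were the greedy choice never blocked, dependent choice
    would give an infinite independent sequence. *)
Lemma greedy_stops (P : V -> Prop) (Inv : seq V -> Prop) :
  no_infinite_indep P -> Inv [::] ->
  (forall l a, Inv (rcons l a) -> P a) -> (forall l, Inv l -> indep l) ->
  exists2 l, Inv l & forall a, ~ Inv (rcons l a).
Proof.
move=> fin Inv0 InvP Invi; apply: contrapT => nex; apply: fin.
have [|u Hu] := @greedy_sequence _ Inv Inv0.
  move=> l Hl; apply: contrapT => na; apply: nex; exists l => // a Ha.
  by apply: na; exists a.
by exists u => m; split; [apply: (InvP (mkseq u m)); rewrite -mkseqS|apply: Invi].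
Qed.

End Span.

(* Passing to a submodule [N] of [M] through a linear map with kernel [N]: an
   infinite independent sequence of [M] either stays independent modulo [N] from
   some point on, or has nonzero combinations in [N] of infinitely many disjoint
   blocks. *)
Lemma no_infinite_indep_ext (R : nzRingType) (V W : lmodType R)
    (M N : V -> Prop) (phi : {linear V -> W}) :
  (forall u v, M u -> M v -> M (u + v)) -> (forall r u, M u -> M (r *: u)) ->
  (forall u, M u -> phi u = 0 -> N u) ->
  no_infinite_indep N -> no_infinite_indep (fun _ : W => True) ->
  no_infinite_indep M.
Proof.
move=> MD MZ MN finN finW [u Hu].
have M0 : M 0 by rewrite -(scale0r (u 0)); apply: MZ; case: (Hu 0).
have Mspan s : (forall a, a \in s -> exists k, a = u k) -> forall y, in_span s y -> M y.
  move=> Hs y; apply: in_span_least => // a /Hs[k ->]; by case: (Hu k).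
have iN K m : indep (mkseq u K ++ mkseq (fun i => u (K + i)%N) m).
  by rewrite -mkseqD; case: (Hu (K + m)%N).
have [[K HK]|nK] := pselect (exists K, forall m y,
    in_span (mkseq (fun i => u (K + i)%N) m) y -> N y -> y = 0).
  apply: finW; exists (fun i => phi (u (K + i)%N)) => m; split=> //.
  set v := fun i => u (K + i)%N in HK *.
  have iv k : indep (mkseq v k) by have [] := indep_cat (iN K k).
  have Mv k y : in_span (mkseq v k) y -> M y.
    by apply: Mspan => a /mapP[i _ ->]; exists (K + i)%N.
  elim: m => // m IH; rewrite mkseqS; apply/indep_rcons.
  have := iv m.+1; rewrite mkseqS => /indep_rcons[il v0 Hv].
  split=> //.
    move=> phi0; apply: v0; apply: (HK m.+1); last first.
      by apply: MN => //; rewrite /v; case: (Hu (K + m)%N).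
    by apply: in_span_mem; rewrite mkseqS mem_rcons mem_head.
  move=> r Hr.
  have [y Hy Ey] : exists2 y, in_span (mkseq v m) y & phi y = r *: phi (v m).
    move: Hr; apply: (@in_span_least _ _
      (fun z => exists2 y, in_span (mkseq v m) y & phi y = z)).
    - by exists 0; [exact: in_span0|rewrite linear0].
    - move=> _ _ [a Ha <-] [b Hb <-]; exists (a + b); last by rewrite linearD.
      exact: in_spanD.
    - move=> s _ [a Ha <-]; exists (s *: a); last by rewrite linearZ.
      exact: in_spanZ.
    - by move=> _ /mapP[i Hi ->]; exists (v i) => //; apply/in_span_mem/map_f.
  have E : r *: v m - y = 0.
    have Hs : in_span (mkseq v m.+1) (r *: v m - y).
      apply: in_spanB; first by apply/in_spanZ/in_span_mem; rewrite mkseqS mem_rcons mem_head.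
      by apply: in_span_sub Hy => z; rewrite mkseqS mem_rcons inE orbC => ->.
    apply: (HK m.+1) => //; apply: MN; first exact: Mv Hs.
    by rewrite linearB linearZ /= Ey subrr.
  rewrite -linearZ /= Hv ?linear0 //.
  by move/eqP: E; rewrite subr_eq0 => /eqP ->.
pose Inv l := [/\ indep l, (forall a, a \in l -> N a) &
  exists K, forall a, a \in l -> in_span (mkseq u K) a].
have [|||l [il Nl [K HK]] nl] := @greedy_stops _ _ N Inv finN.
- by split=> [|a|] //; exists 0%N => a.
- by move=> l a [_ H _]; apply: H; rewrite mem_rcons mem_head.
- by move=> l [].
apply: nK; exists K => m y Hy Ny; apply: contrapT => y0; apply: (nl y).
have [_ Hcat] := indep_cat (iN K m).
split.
- apply/indep_rcons; split=> // r Hr; apply: Hcat; last exact: in_spanZ.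
  move: Hr; apply: in_span_least => //; [exact: in_span0|exact: in_spanD|exact: in_spanZ].
- by move=> a; rewrite mem_rcons inE => /orP[/eqP ->|/Nl].
exists (K + m)%N => a; rewrite mem_rcons inE mkseqD.
case/orP => [/eqP ->|/HK Ha].
  by apply: in_span_sub Hy => z; rewrite mem_cat orbC => ->.
by apply: in_span_sub Ha => z; rewrite mem_cat => ->.
Qed.

(** * Uniform dimension *)

Section LeftIdeals.
Variable R : nzRingType.
Local Notation lspan := (@in_span R R^o).
Local Notation lindep := (@indep R R^o).
Implicit Types (I J : R -> Prop) (a b c r : R) (l us ws : seq R).

Definition essential I : Prop := forall a, a <> 0 -> exists r, r * a <> 0 /\ I (r * a).

(** Vanishing of the left singular ideal. *)
Definition nonsingular : Prop := forall b, essential (fun r => r * b = 0) -> b = 0.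

Definition finite_udim : Prop := @no_infinite_indep R R^o (fun _ => True).

Definition uniform u : Prop := u <> 0 /\ forall s t : R, s * u <> 0 -> t * u <> 0 ->
  exists p q : R, p * (s * u) = q * (t * u) /\ p * (s * u) <> 0.

Lemma lideal_lspan l : is_left_ideal (lspan l).
Proof. by split; [exact: in_span0|exact: in_spanD|exact: in_spanZ]. Qed.

Lemma essentialS I J : (forall a, I a -> J a) -> essential I -> essential J.
Proof. by move=> IJ eI a /eI[r [r0 /IJ]]; exists r. Qed.

Lemma essentialI I J : is_left_ideal I -> essential I -> essential J ->
  essential (fun a => I a /\ J a).
Proof.
move=> [_ _ IZ] eI eJ a /eI[r [/eJ[s [s0 Js]] Ir]].
by exists (s * r); rewrite -mulrA; split=> //; split=> //; apply: IZ.
Qed.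

Lemma not_essentialP I : ~ essential I ->
  exists2 a, a <> 0 & forall r, I (r * a) -> r * a = 0.
Proof.
move=> nI; apply: contrapT => na; apply: nI => a a0; apply: contrapT => nr.
apply: na; exists a => // r Ir; apply: contrapT => ra0; apply: nr.
by exists r.
Qed.

Lemma semiprime_elt : semiprime R -> forall a, (forall r, a * r * a = 0) -> a = 0.
Proof.
move=> sR a Ha.
pose J x := exists s : seq (R * R), x = \sum_(p <- s) p.1 * a * p.2.
have JJ x y : J x -> J y -> x * y = 0.
  move=> [s ->] [t ->]; rewrite big_distrl big1 //= => p _.
  rewrite big_distrr big1 //= => q _.
  rewrite -!mulrA [_ * (a * _)](_ : _ = p.1 * (a * (p.2 * q.1) * a) * q.2).
    by rewrite Ha mulr0 mul0r.
  by rewrite !mulrA.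
have J0 : J 0 by exists [::]; rewrite big_nil.
have JD x y : J x -> J y -> J (x + y).
  by move=> [s ->] [t ->]; exists (s ++ t); rewrite big_cat.
apply: (sR J) => //; last by exists [:: (1, 1)]; rewrite big_seq1 mul1r mulr1.
split; split=> // r _ [s ->].
  exists [seq (r * p.1, p.2) | p <- s]; rewrite big_map big_distrr /=.
  by apply: eq_bigr => p _; rewrite !mulrA.
exists [seq (p.1, p.2 * r) | p <- s]; rewrite big_map big_distrl /=.
by apply: eq_bigr => p _; rewrite !mulrA.
Qed.

Lemma acc_lann_max (P : R -> Prop) : acc_lann R -> (exists a, P a) ->
  exists2 a, P a &
    forall b, P b -> (forall r, r * a = 0 -> r * b = 0) ->
      forall r, r * b = 0 -> r * a = 0.
Proof.
move=> acc [a0 Pa0]; apply: contrapT => nmax.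
have /choice[nxt Hn] : forall a, exists b, P a ->
    [/\ P b, (forall r, r * a = 0 -> r * b = 0) &
       exists2 r, r * b = 0 & r * a <> 0].
  move=> a; have [Pa|nPa] := pselect (P a); last by exists a.
  apply: contrapT => nb; apply: nmax; exists a => // b Pb sub r rb.
  apply: contrapT => ra; apply: nb; exists b => _; split=> //; by exists r.
pose u k := iter k nxt a0.
have Pu k : P (u k) by elim: k => //= k /Hn[].
have [|k r|N HN] := acc (fun k r => r * u k = 0).
- move=> k; exists (fun s => s = u k) => r; split=> [H _ -> //|H]; exact: H.
- by have [_ H _] := Hn _ (Pu k); exact: H.
have [_ _ [r rb ra]] := Hn _ (Pu N); apply: ra.
exact: (HN N.+1).
Qed.

(** Utumi's argument. If [R a] were nil, so would be [a R]. Take a nonzero [x] in [a R] with maximal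
    left annihilator; if [x * r] is nonzero, let [y] be its last nonzero power. The annihilator of
    [y] contains that of [x], hence equals it, and [x * r * y = 0] forces [x * r * x = 0]. Thus
    [x R x = 0], against semiprimeness. *)
Lemma nonnil_left_ideal : semiprime R -> acc_lann R ->
  forall a, a <> 0 -> exists r, forall k, (r * a) ^+ k <> 0.
Proof.
move=> sR acc a a0; apply: contrapT => nil.
have Hnil y : exists k, (y * a) ^+ k = 0.
  apply: contrapT => nk; apply: nil; exists y => k yk; apply: nk; by exists k.
have [|x [x0 [s Es]] maxx] :=
    @acc_lann_max (fun x => x <> 0 /\ exists s, x = a * s) acc.
  by exists a; split=> //; exists 1; rewrite mulr1.
apply: x0; apply: semiprime_elt => // r.
have ex : exists k, (x * r) ^+ k == 0.
  have [k Hk] := Hnil (s * r); exists k.+1; apply/eqP.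
  rewrite Es -mulrA; set y := s * r in Hk *.
  have -> : (a * y) ^+ k.+1 = a * (y * a) ^+ k * y.
    elim: k {Hk} => [|k IH]; first by rewrite expr1 expr0 mulr1.
    by rewrite exprS IH exprS !mulrA.
  by rewrite Hk mulr0 mul0r.
case: (ex_minnP ex) => -[|k] /eqP Hk Hmin.
  by move/eqP: Hk; rewrite expr0 oner_eq0.
case: k Hk Hmin => [|k] Hk Hmin; first by rewrite expr1 in Hk; rewrite Hk mul0r.
apply: (maxx ((x * r) ^+ k.+1)); last by rewrite -exprS.
- split; first by move=> E; have := Hmin k.+1; rewrite E eqxx ltnn => /(_ isT).
  by exists (s * r * (x * r) ^+ k); rewrite exprS {1}Es !mulrA.
- by move=> t tx; rewrite exprS !mulrA tx !mul0r.
Qed.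

(** Among the nonzero elements with essential annihilator take [a] with maximal annihilator. If
    [a * r * a] is nonzero, it has the same annihilator as [a]. But the annihilator of [r * a] is
    essential and so contains some nonzero [s * a]; then [s] kills [a * r * a] and not [a]. *)
Lemma semiprime_nonsingular : semiprime R -> acc_lann R -> nonsingular.
Proof.
move=> sR acc b eb; apply: contrapT => b0.
have [|a [a0 ea] maxa] :=
  @acc_lann_max (fun a => a <> 0 /\ essential (fun r => r * a = 0)) acc.
  by exists b.
apply: a0; apply: semiprime_elt => // r; apply: contrapT => ara.
have era : essential (fun t => t * (r * a) = 0).
  move=> t t0; have [tr0|tr0] := pselect (t * r = 0).
    by exists 1; rewrite mul1r mulrA tr0 mul0r.
  have [p [p0 Hp]] := ea _ tr0; exists p; rewrite !mulrA in p0 Hp *; split=> //.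
  by move=> pt; apply: p0; rewrite pt mul0r.
have a0 : a <> 0 by move=> a0; apply: ara; rewrite a0 mulr0.
have [s [s0 Hs]] := era _ a0; apply: s0.
apply: (maxa (a * r * a)); last by rewrite -!mulrA; rewrite -!mulrA in Hs.
  split=> // t t0; have [p [p0 Hp]] := ea _ t0; exists p; split=> //.
  by rewrite !mulrA Hp !mul0r.
by move=> t ta; rewrite !mulrA ta !mul0r.
Qed.

Lemma exists_sqreg_power : acc_lann R -> forall w,
  exists N, forall r, r * w ^+ N.+1 * w ^+ N.+1 = 0 -> r * w ^+ N.+1 = 0.
Proof.
move=> acc w; have [|k r|N HN] := acc (fun k r => r * w ^+ k.+1 = 0).
- move=> k; exists (fun s => s = w ^+ k.+1) => r; split=> [H _ -> //|H]; exact: H.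
- by move=> H; rewrite exprSr mulrA H mul0r.
exists N => r H; apply: (HN (N + N.+1)%N); first exact: leq_addr.
by rewrite -addSn exprD mulrA.
Qed.

Lemma finite_left_udimP : finite_left_udim R <-> finite_udim.
Proof.
split=> fin [u Hu]; apply: fin.
  exists (fun k r => exists s, r = s * u k); split.
  - move=> k; split; first by exists 0; rewrite mul0r.
      by move=> _ _ [s ->] [t ->]; exists (s + t); rewrite mulrDl.
    by move=> r _ [s ->]; exists (r * s); rewrite mulrA.
  - move=> k; exists (u k); split; first by exists 1; rewrite mul1r.
    have [_ /indep_neq0] := Hu k.+1; apply.
    by rewrite mkseqS mem_rcons mem_head.
  elim=> // m IH a Ha; rewrite big_ord_recr /= => E.
  have am0 : a m = 0.
    have [_] := Hu m.+1; rewrite mkseqS => /indep_rcons[_ _ H].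
    have [s Es] := Ha m (leqnn _); rewrite Es; apply: (H s).
    rewrite -[_ *: _]/(s * u m) -Es.
    have -> : a m = - \sum_(i < m) a i by apply/eqP; rewrite -addr_eq0 addrC E.
    apply: in_spanN; apply: (big_ind (fun x => lspan (mkseq u m) x)).
    - exact: in_span0.
    - exact: in_spanD.
    - move=> i _; have [t ->] := Ha i (leqW (ltn_ord i)).
      by apply: (@in_spanZ R R^o); apply: in_span_mem; apply: map_f; rewrite mem_iota /=.
  move=> i; rewrite ltnS leq_eqVlt => /orP[/eqP -> //|im].
  by apply: IH => // [j jm|]; [apply: Ha; apply: leqW|rewrite am0 addr0 in E].
have [lI nzI iI] := Hu.
have /choice[a Ha] := nzI.
exists a => m; split=> //; elim: m => // m IH; rewrite mkseqS.
apply/indep_rcons; split=> //; first by case: (Ha m).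
move=> r Hr.
have [c Hc] : exists c : nat -> R, - (r * a m) = \sum_(i < m) c i * a i.
  have {Hr}/(@in_spanN R R^o) := Hr.
  rewrite -[_ *: _]/(r * a m); move: (- _) => y; elim: m {IH} y => [|m IH] y.
    by move=> ->; exists (fun=> 0); rewrite big_ord0.
  rewrite mkseqS => /in_span_rcons[s /IH[c Hc]].
  exists (fun i => if i == m then s else c i); rewrite big_ord_recr /= eqxx.
  rewrite -[LHS](subrK (s * a m)) Hc; congr (_ + _); apply: eq_bigr => i _.
  by rewrite ltn_eqF.
pose d i := if i == m then r * a m else c i * a i.
have -> : r *: (a m : R^o) = d m by rewrite /d eqxx.
apply: (iI m.+1) => // [i _|].
  by rewrite /d; have [_ _ H] := lI i; case: eqP => [<-|_]; apply: H; case: (Ha i).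
rewrite big_ord_recr /= {2}/d eqxx.
have -> : \sum_(i < m) d i = - (r * a m).
  by rewrite Hc; apply: eq_bigr => i _; rewrite /d ltn_eqF.
by rewrite addNr.
Qed.

(** * Uniform elements and the exchange argument *)

Lemma uniform_multiple s u : uniform u -> s * u <> 0 -> uniform (s * u).
Proof.
move=> [u0 Hu] su0; split=> // p q; rewrite !mulrA => p0 q0.
have [p' [q' [E nz]]] := Hu _ _ p0 q0; exists p', q'.
by rewrite -!mulrA in E nz *.
Qed.

(** The invariant keeps in reserve a nonzero multiple [b] of [a] whose left ideal misses the span.
    If [b] is not uniform, it has two independent nonzero multiples: one joins the family and the
    other becomes the new reserve. *)
Lemma uniform_below : finite_udim -> forall a, a <> 0 -> exists r, uniform (r * a).
Proof.
move=> fin a a0; apply: contrapT => nu.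
pose Inv l := lindep l /\ exists b, [/\ exists r, b = r * a, b <> 0 &
  forall r, lspan l (r * b) -> r * b = 0].
have [|//|l []//|l [il [b [[r ->] b0 Hb]]] nl] := @greedy_stops R R^o _ Inv fin.
  by split=> //; exists a; split=> //; exists 1; rewrite mul1r.
apply: nu; exists r; split=> // s t s0 t0; apply: contrapT => npq.
apply: (nl (s * (r * a))); split.
  by apply/indep_rcons; split=> // p; rewrite -[_ *: _]/(p * (s * (r * a))) mulrA => /Hb.
exists (t * (r * a)); split=> //; first by exists (t * r); rewrite mulrA.
move=> q /in_span_rcons[p]; rewrite -[_ *: _]/(p * (s * (r * a))) => Hp.
have E : q * (t * (r * a)) = p * (s * (r * a)).
  apply/eqP; rewrite -subr_eq0; apply/eqP; move: Hp.
  by rewrite [q * _]mulrA [p * _]mulrA -mulrBl => /Hb.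
by rewrite E; apply: contrapT => nz; apply: npq; exists p, q; rewrite E.
Qed.

(** If [J] meets [R u] for a uniform [u], the elements [t] with [t * u] in [J] form an essential
    left ideal, and this property passes to all combinations of [us]. A combination [x] with [R x]
    missing [J] would then have an essential annihilator, so [x = 0] by nonsingularity. *)
Lemma essential_of_uniform_family J us : nonsingular -> is_left_ideal J ->
  (forall u, u \in us -> uniform u /\ exists r, r * u <> 0 /\ J (r * u)) ->
  essential (lspan us) -> essential J.
Proof.
move=> ns [J0 JD JZ] Hus eus.
have H x : lspan us x -> essential (fun t => J (t * x)).
  apply: (@in_span_least R R^o (fun x => essential (fun t => J (t * x)))).
  - by move=> a a0; exists 1; rewrite mul1r mulr0.
  - move=> u v Wu Wv; apply: (essentialS _ (essentialI _ Wu Wv)).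
      by move=> t [tu tv]; rewrite mulrDr; apply: JD.
    split=> [|s t Hs Ht|s t Ht]; first by rewrite mul0r.
      by rewrite mulrDl; apply: JD.
    by rewrite -mulrA; apply: JZ.
  - move=> r u Wu a a0; rewrite -[_ *: _]/(r * u).
    have [ar0|ar0] := pselect (a * r = 0).
      by exists 1; rewrite mul1r mulrA ar0 mul0r.
    have [t [t0 Ht]] := Wu _ ar0; exists t; rewrite !mulrA in t0 Ht *; split=> //.
    by move=> ta; apply: t0; rewrite ta mul0r.
  - move=> u /Hus[[u0 Hu] [r [r0 Jr]]] a a0.
    have [au0|au0] := pselect (a * u = 0); first by exists 1; rewrite mul1r au0.
    have [p [q [E nz]]] := Hu _ _ au0 r0; exists p; rewrite -mulrA E; split.
      by move=> pa; apply: nz; rewrite mulrA pa mul0r.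
    exact: JZ.
move=> a a0; have [r [r0 /H er]] := eus _ a0.
apply: contrapT => nt; apply: r0; apply: ns; apply: essentialS er => t Jt.
by apply: contrapT => nz; apply: nt; exists (t * r); rewrite -mulrA.
Qed.

(** Steinitz exchange: the members of [ws] are traded one at a time for members of [us], collected
    in [ch]. A trade is always possible, since otherwise the span of the other elements would meet
    every [R u], hence be essential and meet [R w]. *)
Lemma exchange us ws : nonsingular -> (forall u, u \in us -> uniform u) ->
  essential (lspan us) -> lindep ws -> (size ws <= size us)%N.
Proof.
move=> ns Hus eus; suff H (ch : seq R) : {subset ch <= us} ->
    lindep (ch ++ ws) -> (size ch + size ws <= size us)%N by apply: (H [::]).
elim/last_ind: ws ch => [|ws w IH] ch sub.
  by rewrite cats0 addn0 => /indep_uniq uch; apply: uniq_leq_size.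
rewrite -rcons_cat => /indep_rcons[il w0 Hw].
have [u uus Hu] : exists2 u, u \in us & forall r, lspan (ch ++ ws) (r * u) -> r * u = 0.
  apply: contrapT => nu; have [r [r0 /Hw]] : exists r, r * w <> 0 /\ lspan (ch ++ ws) (r * w).
    apply: (essential_of_uniform_family ns (lideal_lspan _) _ eus) w0 => u uus.
    split; first exact: Hus.
    apply: contrapT => nr; apply: nu; exists u => // r Hr.
    by apply: contrapT => r0; apply: nr; exists r.
  by [].
rewrite size_rcons addnS; apply: (IH (u :: ch)).
  by move=> x; rewrite inE => /orP[/eqP ->|/sub].
by split=> //; case: (Hus _ uus).
Qed.

Lemma essential_of_full_size us ws : nonsingular -> (forall u, u \in us -> uniform u) ->
  essential (lspan us) -> lindep ws -> size ws = size us -> essential (lspan ws).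
Proof.
move=> ns Hus eus iws sz; apply: contrapT => /not_essentialP[a a0 Ha].
have : (size (a :: ws) <= size us)%N by apply: exchange.
by rewrite /= sz ltnn.
Qed.

(** If [R a] missed [R c], the elements [a], [a * c], [a * c ^+ 2], ... would be independent: right
    multiplication by [c] is injective and shifts the sequence into [R c]. *)
Lemma essential_principal c : finite_udim -> (forall a, a * c = 0 -> a = 0) ->
  essential (fun x => exists y, x = y * c).
Proof.
move=> fin Hc; apply: contrapT => /not_essentialP[a a0 Ha]; apply: fin.
exists (fun k => a * c ^+ k) => m; split=> //.
have E k : mkseq (fun k => a * c ^+ k) k.+1 =
    a :: [seq x * c | x <- mkseq (fun k => a * c ^+ k) k].
  rewrite /mkseq /= expr0 mulr1 -map_comp (iotaDl 1 0) -map_comp; congr cons.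
  by apply: eq_map => i /=; rewrite -mulrA -exprSr add1n.
have Hspan (l : seq R) x : lspan [seq y * c | y <- l] x ->
    exists2 y, lspan l y & x = y * c.
  apply: (@in_span_least R R^o (fun x => exists2 y, lspan l y & x = y * c)).
  - by exists 0; [exact: in_span0|rewrite mul0r].
  - move=> _ _ [y Hy ->] [z Hz ->]; exists (y + z); last by rewrite mulrDl.
    exact: in_spanD.
  - move=> r _ [y Hy ->]; exists (r * y); last by rewrite -mulrA.
    exact: (@in_spanZ R R^o).
  - by move=> _ /mapP[y yl ->]; exists y => //; apply: in_span_mem.
elim: m => // m IH; rewrite E; split=> //.
  by move=> r /Hspan[y _ Ey]; apply: Ha; exists y.
elim: (mkseq _ m) IH => //= b l IHl [b0 Hb il]; split.
- by move=> /Hc.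
- move=> r /Hspan[y Hy]; rewrite -[_ *: _]/(r * (b * c)) mulrA => E1.
  have Ey : r * b = y by apply/eqP; rewrite -subr_eq0; apply/eqP/Hc; rewrite mulrBl E1 subrr.
  by rewrite [r * b]Hb ?mul0r // -[_ *: _]/(r * b) Ey.
- exact: IHl.
Qed.

(** One-sided cancellation suffices: if [c * b = 0], the essential left ideal [R c] annihilates
    [b]. *)
Lemma regularP c : nonsingular -> finite_udim ->
  (forall a, a * c = 0 -> a = 0) -> regular c.
Proof.
move=> ns fin Hc; split=> // b cb; apply: ns.
by apply: essentialS (essential_principal fin Hc) => _ [y ->]; rewrite -mulrA cb mulr0.
Qed.

Lemma regularM b c : regular b -> regular c -> regular (b * c).
Proof.
move=> [lb rb] [lc rc]; split=> a; first by rewrite -mulrA => /lb/lc.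
by rewrite mulrA => /rc/rb.
Qed.

Lemma regular_left_factor b c : nonsingular -> finite_udim ->
  regular (b * c) -> regular c.
Proof.
move=> ns fin [_ Hbc]; apply: regularP => // r rc; apply: contrapT => r0.
have eb : essential (fun x => exists y, x = y * b).
  by apply: essential_principal => // a ab; apply: Hbc; rewrite mulrA ab mul0r.
have [s [s0 [y Ey]]] := eb _ r0.
apply: s0; rewrite Ey (Hbc y) ?mul0r //.
by rewrite mulrA -Ey -mulrA rc mulr0.
Qed.

(** * Left annihilators in nonsingular rings *)

Lemma nonsingular_elt b : nonsingular -> b <> 0 ->
  exists2 t, t <> 0 & forall r, r * t * b = 0 -> r * t = 0.
Proof. by move=> ns b0; apply: (@not_essentialP (fun r => r * b = 0)) => /ns. Qed.

(** Annihilators are never essential in a larger left ideal. This converts strict growth of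
    annihilators into growth of an independent family. *)
Lemma lann_step (S : R -> Prop) y : nonsingular -> ~ lann S y ->
  exists2 t, t * y <> 0 & forall r, lann S (r * (t * y)) -> r * (t * y) = 0.
Proof.
move=> ns nSy.
have [s [Ss sy]] : exists s, S s /\ y * s <> 0.
  apply: contrapT => ns'; apply: nSy => s Ss; apply: contrapT => ys; apply: ns'.
  by exists s.
have [t t0 Ht] := nonsingular_elt ns sy; exists t.
  by move=> ty; apply: t0; rewrite -[t]mul1r; apply: Ht; rewrite mul1r mulrA ty mul0r.
by move=> r /(_ s Ss) H; rewrite mulrA Ht ?mul0r // -H !mulrA.
Qed.

Lemma nonsingular_acc_lann : nonsingular -> finite_udim -> acc_lann R.
Proof.
move=> ns fin f Hf fS; apply: contrapT => nN.
have mono m k r : (m <= k)%N -> f m r -> f k r.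
  by move=> /subnKC <-; elim: (k - m)%N => [|i IH]; rewrite ?addn0 // addnS => /IH/fS.
have lf k : is_left_ideal (f k).
  have [S HS] := Hf k; split; first by apply/HS => s _; rewrite mul0r.
    by move=> a b /HS Ha /HS Hb; apply/HS => s Ss; rewrite mulrDl Ha // Hb // addr0.
  by move=> r a /HS Ha; apply/HS => s Ss; rewrite -mulrA Ha // mulr0.
pose Inv (l : seq R) := lindep l /\ exists N, forall a, a \in l -> f N a.
have [|//|l []//|l [il [N HN]] nl] := @greedy_stops R R^o _ Inv fin.
  by split=> //; exists 0%N.
apply: nN; exists N => k _ r fr; apply: contrapT => nfr.
have [S HS] := Hf N; have nS : ~ lann S r by move=> /HS.
have [t ty Ht] := lann_step ns nS; apply: (nl (t * r)); split.
  apply/(@indep_rcons R R^o); split=> // p Hp.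
  apply: Ht; apply/HS; have [f0 fD fZ] := lf N.
  by move: Hp; apply: (@in_span_least R R^o).
exists (maxn N k) => a; rewrite mem_rcons inE => /orP[/eqP ->|/HN Ha].
  by have [_ _ fZ] := lf (maxn N k); apply/fZ/(mono k) => //; apply: leq_maxr.
by apply: mono Ha; apply: leq_maxl.
Qed.

(* A strictly increasing chain of left annihilators of powers of [b] would be too
   long for the uniform dimension [size us]. *)
Lemma lann_power us b : nonsingular -> (forall u, u \in us -> uniform u) ->
  essential (lspan us) ->
  forall r, r * b ^+ (size us + size us) = 0 -> r * b ^+ size us = 0.
Proof.
move=> ns Hus eus; set n := size us.
have [k kn Hk] : exists2 k, (k <= n)%N & forall r, r * b ^+ k.+1 = 0 -> r * b ^+ k = 0.
  apply: contrapT => nk.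
  have H k : (k <= n.+1)%N ->
      exists l, [/\ lindep l, size l = k & forall a, a \in l -> a * b ^+ k = 0].
    elim: k => [|k IH] kn; first by exists [::].
    have [l [il sl Hl]] := IH (ltnW kn).
    have [y yk1 yk] : exists2 y, y * b ^+ k.+1 = 0 & y * b ^+ k <> 0.
      apply: contrapT => ny; apply: nk; exists k => // r r1.
      by apply: contrapT => r0; apply: ny; exists r.
    have nS : ~ lann (eq (b ^+ k)) y by move=> /(_ _ erefl).
    have [t ty Ht] := lann_step ns nS; exists (rcons l (t * y)); split.
    - apply/(@indep_rcons R R^o); split=> // r Hr; apply: Ht => _ <-.
      move: Hr; apply: (@in_span_least R R^o (fun x => x * b ^+ k = 0)) => //.
      + by rewrite mul0r.
      + by move=> u v Hu Hv; rewrite mulrDl Hu Hv addr0.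
      + by move=> s u Hu; rewrite -[_ *: _]/(s * u) -mulrA Hu mulr0.
    - by rewrite size_rcons sl.
    - move=> a; rewrite mem_rcons inE => /orP[/eqP ->|/Hl Ha].
        by rewrite -mulrA yk1 mulr0.
      by rewrite exprSr mulrA Ha mul0r.
  have [l [il sl _]] := H n.+1 (leqnn _).
  by have := exchange ns Hus eus il; rewrite sl ltnn.
have Hkm m r : r * b ^+ (k + m) = 0 -> r * b ^+ k = 0.
  elim: m => [|m IH]; first by rewrite addn0.
  rewrite addnS -addSn addnC exprD mulrA => /Hk.
  by rewrite -mulrA -exprD addnC => /IH.
move=> r Hr; rewrite -(subnKC kn) exprD mulrA (Hkm (n + n - k)%N) ?mul0r //.
by rewrite subnKC // (leq_trans kn) // leq_addr.
Qed.

(** * Triangular families *)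

Definition sqreg b : Prop := forall r, r * b * b = 0 -> r * b = 0.

(** Right multiplication by the members of [l] acts on the span of [l] like a triangular matrix:
    later members times earlier ones vanish, and [sqreg] makes each diagonal entry injective on
    [R b]. *)
Fixpoint triangular l : Prop :=
  if l is b :: l' then
    [/\ b <> 0, sqreg b, (forall x, x \in l' -> x * b = 0) & triangular l']
  else True.

Lemma triangular_rcons l a : triangular l -> a <> 0 -> sqreg a ->
  (forall b, b \in l -> a * b = 0) -> triangular (rcons l a).
Proof.
elim: l => [|b l IH] /=; first by [].
move=> [b0 sb Hb tl] a0 sa Ha; split=> //.
  move=> x; rewrite mem_rcons inE => /orP[/eqP ->|/Hb//].
  by apply: Ha; rewrite mem_head.
by apply: IH => // x xl; apply: Ha; rewrite inE xl orbT.
Qed.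

Lemma lspan_mul0 l b x : (forall y, y \in l -> y * b = 0) -> lspan l x -> x * b = 0.
Proof.
move=> Hl; apply: (@in_span_least R R^o (fun x => x * b = 0)) => //.
- by rewrite mul0r.
- by move=> u v Hu Hv; rewrite mulrDl Hu Hv addr0.
- by move=> s u Hu; rewrite -[_ *: _]/(s * u) -mulrA Hu mulr0.
Qed.

(** Forward substitution: multiplying a combination on the right by the first member kills all later
    terms, so [sqreg] removes the first term. *)
Lemma triangular_lspan0 l y : triangular l -> lspan l y ->
  (forall b, b \in l -> y * b = 0) -> y = 0.
Proof.
elim: l y => [|b l IH] y //= [b0 sb Hb tl] [r Hr] Hy.
have rb : r * b = 0.
  apply: sb; have := lspan_mul0 Hb Hr; rewrite mulrBl Hy ?mem_head // sub0r.
  by move/eqP; rewrite oppr_eq0 => /eqP.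
apply: IH => // [|x xl]; last by apply: Hy; rewrite inE xl orbT.
by rewrite -[_ *: _]/(r * b) rb subr0 in Hr.
Qed.

Lemma triangular_indep l : triangular l -> lindep l.
Proof.
elim: l => //= b l IH [b0 sb Hb /IH il]; split=> // r Hr.
by apply: sb; apply: lspan_mul0 Hb Hr.
Qed.

Lemma lspan_sum l z : lspan l (z * \sum_(b <- l) b).
Proof.
rewrite big_distrr /= big_seq; apply: (big_ind (fun x => lspan l x)).
- exact: in_span0.
- exact: in_spanD.
- by move=> b bl; apply: (@in_spanZ R R^o); apply: in_span_mem.
Qed.

Lemma indep_sum l z : lindep l -> z * \sum_(b <- l) b = 0 ->
  forall b, b \in l -> z * b = 0.
Proof.
elim: l => // a l IH [a0 Ha il]; rewrite big_cons mulrDr => E.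
have za : z * a = 0.
  apply: Ha; rewrite -[_ *: _]/(z * a).
  have -> : z * a = - (z * \sum_(b <- l) b) by apply/eqP; rewrite -addr_eq0 E.
  apply: in_spanN; exact: lspan_sum.
by move: E; rewrite za add0r => E b; rewrite inE => /orP[/eqP ->|/IH]; last apply.
Qed.

Lemma triangular_sum_lann l z : triangular l -> essential (lspan l) ->
  z * \sum_(b <- l) b = 0 -> z = 0.
Proof.
move=> tl el /(indep_sum (triangular_indep tl)) Hz; apply: contrapT => z0.
have [r [r0 Hr]] := el _ z0; apply: r0; apply: (triangular_lspan0 tl Hr).
by move=> b /Hz; rewrite -mulrA => ->; rewrite mulr0.
Qed.

End LeftIdeals.

(** * Regular elements of semiprime Goldie rings *)

Section SemiprimeGoldie.
Variable R : nzRingType.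
Local Notation lspan := (@in_span R R^o).
Local Notation lindep := (@indep R R^o).
Implicit Types (I J : R -> Prop) (a b c r : R) (l us ws : seq R).
Hypotheses (sR : semiprime R) (accR : acc_lann R) (finR : finite_udim R).
Let ns : nonsingular R := semiprime_nonsingular sR accR.

Lemma goldie_family I : is_left_ideal I -> essential I ->
  exists l, [/\ triangular l, forall b, b \in l -> I b,
    forall b, b \in l -> uniform b & essential (lspan l)].
Proof.
move=> [I0 ID IZ] eI.
pose Inv l := [/\ triangular l, forall b, b \in l -> I b & forall b, b \in l -> uniform b].
have [//|//|l [tl _ _]|l [tl Il Ul] nl] := @greedy_stops R R^o _ Inv finR.
  exact: triangular_indep.
exists l; split=> //.
(* A nonzero [z] killing all of [l] would extend [l]: some multiple of [z] lies in [I], a further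
   multiple is uniform, a further one is not nilpotent, and a high power of that one is
   square-regular. All these are left multiples of [z], so they still kill [l]. Hence
   [\sum_(b <- l) b] has zero left annihilator and generates an essential left ideal inside the
   span. *)
have l0 z : (forall b, b \in l -> z * b = 0) -> z = 0.
  move=> Hz; apply: contrapT => z0.
  have [r [r0 Ir]] := eI _ z0.
  have [s Us] := uniform_below finR r0.
  have [t nt] := nonnil_left_ideal sR accR (proj1 Us).
  have [N HN] := exists_sqreg_power accR (t * (s * (r * z))).
  set a := (_ ^+ N.+1) in HN.
  have a0 : a <> 0 by apply: nt.
  have Ea : a = (t * (s * (r * z))) ^+ N * t * s * (r * z) by rewrite /a exprSr !mulrA.
  apply: (nl a); split.
  - apply: triangular_rcons => // b /Hz zb.
    by rewrite Ea -!mulrA zb !mulr0.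
  - by move=> b; rewrite mem_rcons inE => /orP[/eqP ->|/Il//]; rewrite Ea; apply: IZ.
  - move=> b; rewrite mem_rcons inE => /orP[/eqP ->|/Ul//].
    have Ea' : a = (t * (s * (r * z))) ^+ N * t * (s * (r * z)) by rewrite Ea !mulrA.
    by rewrite Ea' in a0 *; apply: uniform_multiple.
apply: (essentialS _ (@essential_principal _ (\sum_(b <- l) b) finR _)).
  by move=> _ [y ->]; apply: lspan_sum.
move=> a /(indep_sum (triangular_indep tl)); exact: l0.
Qed.

Lemma essential_regular I : is_left_ideal I -> essential I ->
  exists2 c, I c & regular c.
Proof.
move=> lI eI; have [l [tl Il _ el]] := goldie_family lI eI.
exists (\sum_(b <- l) b).
  by have [I0 ID IZ] := lI; rewrite big_seq; apply: (big_ind I).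
apply: regularP => // a; exact: triangular_sum_lann.
Qed.

(** The left ideal of all [s] with [s * b] in [R c] inherits essentiality from [R c], so it contains
    a regular element. *)
Lemma left_ore c b : regular c -> exists s p, regular s /\ s * b = p * c.
Proof.
move=> [_ Hc].
have lJ : is_left_ideal (fun s => exists p, s * b = p * c).
  split; first by exists 0; rewrite !mul0r.
    by move=> s t [p Hp] [q Hq]; exists (p + q); rewrite !mulrDl Hp Hq.
  by move=> r s [p Hp]; exists (r * p); rewrite -!mulrA Hp.
have [|s [p Hp] rs] := essential_regular lJ; last by exists s, p.
move=> a a0; have [ab|ab] := pselect (a * b = 0).
  by exists 1; rewrite mul1r; split=> //; exists 0; rewrite ab mul0r.
have [r [r0 [y Hy]]] := essential_principal finR Hc ab; exists r.
split; first by move=> ra; apply: r0; rewrite mulrA ra mul0r.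
by exists y; rewrite -mulrA.
Qed.

Lemma dedekind_finite a b : a * b = 1 -> b * a = 1.
Proof.
move=> ab; have [ra _] : regular a.
  by apply: regularP => // x xa; rewrite -[x]mulr1 -ab mulrA xa mul0r.
by apply/eqP; rewrite -subr_eq0; apply/eqP/ra; rewrite mulrBr mulrA ab mul1r mulr1 subrr.
Qed.

(** A predicate on bare functions, so that it applies directly to iterates and to a map of [R] read
    over the converse ring. *)
Record injective_endo (tau : R -> R) : Prop := InjectiveEndo {
  endoB : {morph tau : x y / x - y};
  endoM : {morph tau : x y / x * y};
  endo1 : tau 1 = 1;
  endo_inj : forall x, tau x = 0 -> x = 0 }.

Lemma endo0 tau : injective_endo tau -> tau 0 = 0.
Proof. by move=> tau_e; rewrite -{1}(subrr 0) endoB // subrr. Qed.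

Lemma endoX tau b k : injective_endo tau -> tau (b ^+ k) = tau b ^+ k.
Proof.
by move=> te; elim: k => [|k IH]; rewrite ?expr0 ?endo1 // !exprS endoM // IH.
Qed.

Lemma endo_iter tau k : injective_endo tau -> injective_endo (iter k tau).
Proof.
move=> te; elim: k => [|k IH] //; split=> [x y|x y||x] /=.
- by rewrite (endoB IH) (endoB te).
- by rewrite (endoM IH) (endoM te).
- by rewrite (endo1 IH) (endo1 te).
- by move=> /(endo_inj te)/(endo_inj IH).
Qed.

(* The images of [l] under [b |-> tau (b ^+ size l)] are again triangular, hence
   independent, and there are as many of them as the uniform dimension. *)
Lemma endo_family I : is_left_ideal I -> essential I ->
  exists n l, [/\ forall b, b \in l -> I (b ^+ n.+1),
    forall tau, injective_endo tau ->
      triangular [seq tau (b ^+ n.+1) | b <- l] &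
    forall ws, lindep ws -> size ws = size l -> essential (lspan ws)].
Proof.
move=> lI eI; have [l [tl Il Ul el]] := goldie_family lI eI.
(* The exponent is the length of [l]. It is positive, as an essential span cannot come from the
   empty family, and so [b ^+ n.+1] stays in [R b]. *)
have [n En] : exists n, size l = n.+1.
  case: (l) el => [|x s _]; last by exists (size s).
  by move=> /(_ 1)[|r []//]; apply/eqP/oner_neq0.
exists n, l; split=> [b /Il Ib|tau te|ws iws sz]; last exact: (essential_of_full_size ns Ul el).
  by have [_ _ IZ] := lI; rewrite exprSr; apply: IZ.
(* Here [r] need not lie in the image of [tau], so square-regularity of [b] does not transfer.
   Instead [lann_power] is applied to [tau b] itself, whose power of exponent [size l] is
   square-regular in all of [R]. *)
have Hp b r : r * tau (b ^+ n.+1) * tau (b ^+ n.+1) = 0 -> r * tau (b ^+ n.+1) = 0.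
  rewrite -mulrA endoX // -exprD -En; exact: (lann_power ns Ul el).
elim: (l) tl => //= b s IH [b0 sb Hb /IH ts]; split=> //.
- move=> /(endo_inj te); elim: n {En IH ts Hp} => [|n IH]; first by rewrite expr1.
  case: n IH => [|n] IH; last by rewrite exprSr exprSr => /sb; rewrite -exprSr.
  by rewrite expr2 -{1}[b]mul1r => /sb; rewrite mul1r.
- by move=> r; apply: Hp.
- move=> _ /mapP[x xs ->]; rewrite -endoM // exprSr exprS.
  by rewrite mulrA -(mulrA _ x) Hb // mulr0 mul0r endo0.
Qed.

(** Apply [endo_family] to [I = R c]. Each [b ^+ n.+1] is some [y * c], so its image is
    [tau y * tau c], and the sum of the images is a regular element with right factor [tau c]. *)
Lemma endo_regular tau c : injective_endo tau -> regular c -> regular (tau c).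
Proof.
move=> te [_ Hc].
pose I x := exists y, x = y * c.
have lI : is_left_ideal I.
  split; first by exists 0; rewrite mul0r.
    by move=> _ _ [y ->] [z ->]; exists (y + z); rewrite mulrDl.
  by move=> r _ [y ->]; exists (r * y); rewrite mulrA.
have [n [l [Il Hl ess]]] := endo_family lI (essential_principal finR Hc).
have tt := Hl _ te; have et := ess _ (triangular_indep tt) (size_map _ _).
have : regular (\sum_(b <- [seq tau (b ^+ n.+1) | b <- l]) b).
  by apply: regularP => // a; apply: triangular_sum_lann.
suff [y ->] : exists y, \sum_(b <- [seq tau (b ^+ n.+1) | b <- l]) b = y * tau c.
  exact: regular_left_factor.
rewrite big_map big_seq; apply: (big_ind (fun x => exists y, x = y * tau c)).
- by exists 0; rewrite mul0r.
- by move=> _ _ [y ->] [z ->]; exists (y + z); rewrite mulrDl.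
- by move=> b /Il[y ->]; exists (tau y); rewrite endoM.
Qed.

End SemiprimeGoldie.

(** * Complements of left ideals *)

Lemma left_complement (R : nzRingType) (E : R -> Prop) : is_left_ideal E ->
  exists K, [/\ is_left_ideal K, forall a, E a -> K a -> a = 0 &
    essential (fun a => exists e k, [/\ E e, K k & a = e + k])].
Proof.
move=> [E0 ED EZ].
(* Membership of [0] is left out of [P] so that the union of the empty chain, the empty set,
   satisfies it; maximality of [K] gives [K 0] back through [ext]. *)
pose P (K : set R) := [/\ forall a b, K a -> K b -> K (a + b),
  forall r a, K a -> K (r * a) & forall a, E a -> K a -> a = 0].
have [F sFP tF|K [[KD KZ EK] Kmax]] := @Zorn_bigcup R P.
  split.
  - move=> a b [X FX Xa] [Y FY Yb].
    have [/(_ a Xa) Ya|/(_ b Yb) Xb] := tF _ _ FX FY.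
      by exists Y => //; have [D _ _] := sFP _ FY; apply: D.
    by exists X => //; have [D _ _] := sFP _ FX; apply: D.
  - by move=> r a [X FX Xa]; exists X => //; have [_ Z _] := sFP _ FX; apply: Z.
  - by move=> a Ea [X FX Xa]; have [_ _ H] := sFP _ FX; apply: H.
have ext a : (forall r e k, E e -> K k \/ k = 0 -> r * a = e + k -> r * a = 0) -> K a.
  move=> Ha; apply: contrapT => nKa.
  pose K' := (fun b => exists r k, (K k \/ k = 0) /\ b = k + r * a) : set R.
  apply: (Kmax K'); first split.
  - by move=> b Kb; exists 0, b; rewrite mul0r addr0; split; [left|].
  - move=> sub; apply: nKa; apply: sub; exists 1, 0.
    by rewrite mul1r add0r; split; [right|].
  split.
  - move=> _ _ [r [k [Hk ->]]] [s [m [Hm ->]]]; exists (r + s), (k + m).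
    rewrite mulrDl addrACA; split=> //.
    case: Hk Hm => [Kk|->] [Km|->]; rewrite ?addr0 ?add0r; [left|left|left|right] => //.
    exact: KD.
  - move=> s _ [r [k [Hk ->]]]; exists (s * r), (s * k); rewrite mulrDr mulrA.
    by split=> //; case: Hk => [Kk|->]; [left; apply: KZ|right; rewrite mulr0].
  - move=> b Eb [r [k [Hk E1]]]; rewrite E1 in Eb *.
    have ra : r * a = 0.
      apply: (Ha r _ (- k) Eb); last by rewrite addrC addKr.
      by case: Hk => [Kk|->]; [left; rewrite -mulN1r; apply: KZ|right; rewrite oppr0].
    rewrite ra addr0 in Eb *; case: Hk => [|//]; exact: EK.
have K0 : K 0 by apply: ext => r e k _ _ _; rewrite mulr0.
exists K; split=> //; apply: contrapT => /not_essentialP[a a0 Ha]; apply: a0.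
have Ka : K a.
  apply: ext => r e k Ee Kk E1; apply: Ha; exists e, k; split=> //.
  by case: Kk => [//|->].
rewrite -[a]mul1r; apply: Ha; exists 0, a; split=> //; by rewrite mul1r add0r.
Qed.

(** * Polynomials of bounded degree as left modules *)

Definition coef_regular (R : nzRingType) (m : nat) (p : {poly R}) : R^o := p`_m.

Lemma coef_regular_linear (R : nzRingType) m : linear (@coef_regular R m).
Proof. by move=> a p q; rewrite /coef_regular coefD coefZ. Qed.

HB.instance Definition _ (R : nzRingType) m :=
  GRing.isLinear.Build R {poly R} R^o *:%R (@coef_regular R m)
    (@coef_regular_linear R m).

(** The polynomials of size at most [m] form a copy of [R ^ m]; each step splits off the top
    coefficient. *)
Lemma no_infinite_indep_poly (R : nzRingType) m : finite_udim R ->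
  @no_infinite_indep R {poly R} (fun p => size p <= m)%N.
Proof.
move=> fin; elim: m => [|m IH].
  move=> [u Hu]; have [+ [u0 _]] := Hu 1%N; have [] := Hu 0%N.
  by rewrite leqn0 size_poly_eq0 => /eqP.
apply: (@no_infinite_indep_ext _ _ _ _ _ (@coef_regular R m)) IH fin.
- by move=> p q Hp Hq; apply: leq_trans (size_polyD _ _) _; rewrite geq_max Hp.
- by move=> r p; apply: leq_trans (size_scale_leq _ _).
move=> p sp pm; apply/leq_sizeP => j; rewrite leq_eqVlt => /orP[/eqP <-//|mj].
by apply/leq_sizeP: j mj.
Qed.

(** * Ore extensions *)

Section OreExtension.
Variables (R A : nzRingType) (iota : {rmorphism R -> A}) (x : A) (sigma : R -> R).
Implicit Types (p q h : {poly R}) (a b c r : R).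

(** This map is left [R]-linear but not multiplicative: [{poly R}] serves as the free left module of
    coefficients, and the twisted product of [A] is followed through [shift], which is left
    multiplication by [x] in these coordinates. *)
Definition ev p : A := (map_poly iota p).[x].

Hypotheses (se : injective_endo sigma) (xr : forall r, x * iota r = iota (sigma r) * x).
Hypotheses (ev_surj : forall f, exists p, f = ev p) (ev_eq0 : forall p, ev p = 0 -> p = 0).

Lemma evD p q : ev (p + q) = ev p + ev q.
Proof. by rewrite /ev rmorphD hornerD. Qed.

Lemma evN p : ev (- p) = - ev p.
Proof. by rewrite /ev rmorphN hornerN. Qed.

Lemma evB p q : ev (p - q) = ev p - ev q.
Proof. by rewrite evD evN. Qed.

Lemma evZ r p : ev (r *: p) = iota r * ev p.
Proof.
rewrite /ev -hornerZ; congr (_.[_]); apply/polyP => i.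
by rewrite coef_map /= !coefZ coef_map /= rmorphM.
Qed.

Lemma ev0 : ev 0 = 0.
Proof. by rewrite /ev rmorph0 horner0. Qed.

Lemma ev_coef n p : (size p <= n)%N -> ev p = \sum_(i < n) iota p`_i * x ^+ i.
Proof.
move=> sp; rewrite /ev (@horner_coef_wide _ n); last exact: leq_trans (size_poly _ _) sp.
by apply: eq_bigr => i _; rewrite coef_map.
Qed.

Definition shift p : {poly R} := (\poly_(i < size p) sigma p`_i) * 'X.

Lemma coef_shift p i : (shift p)`_i = if i is i'.+1 then sigma p`_i' else 0.
Proof.
rewrite /shift coefMX; case: i => //= i; rewrite coef_poly.
by case: ltnP => // /leq_sizeP -> //; rewrite endo0.
Qed.

Lemma ev_shift p : ev (shift p) = x * ev p.
Proof.
have -> : ev (shift p) = ev (\poly_(i < size p) sigma p`_i) * x.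
  by rewrite /ev /shift rmorphM /= map_polyX hornerMX.
rewrite (ev_coef (leqnn (size p))) (ev_coef (size_poly _ _)) big_distrl big_distrr /=.
apply: eq_bigr => i _; rewrite coef_poly ltn_ord mulrA xr -!mulrA.
by rewrite -exprSr -exprS.
Qed.

Lemma size_shift p n : (size p <= n)%N -> (size (shift p) <= n.+1)%N.
Proof.
by move=> sp; apply/leq_sizeP => -[|j] // jn; rewrite coef_shift (leq_sizeP _ _ sp) // endo0.
Qed.

Lemma ev_shifts k p : ev (iter k shift p) = x ^+ k * ev p.
Proof. by elim: k => [|k IH]; rewrite ?mul1r //= ev_shift IH mulrA exprS. Qed.

Lemma size_shifts k p n : (size p <= n)%N -> (size (iter k shift p) <= k + n)%N.
Proof. by move=> sp; elim: k => //= k IH; apply: size_shift. Qed.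

Lemma coef_shifts k p m : (iter k shift p)`_(k + m) = iter k sigma p`_m.
Proof. by elim: k => //= k IH; rewrite coef_shift addSn IH. Qed.

Lemma ev_mul_lead h p k m : (size h <= k.+1)%N -> (size p <= m.+1)%N ->
  exists q, [/\ ev h * ev p = ev q, (size q <= (k + m).+1)%N &
    q`_(k + m) = h`_k * iter k sigma p`_m].
Proof.
move=> sh sp; rewrite (ev_coef sh); elim: k h sh => [|k IH] h sh.
  exists (h`_0 *: p); rewrite big_ord1 expr0 mulr1 evZ coefZ; split=> //.
  by rewrite (leq_trans (size_scale_leq _ _)).
have [q [E sq cq]] := IH (\poly_(i < k.+1) h`_i) (size_poly _ _).
exists (q + h`_k.+1 *: iter k.+1 shift p); split.
- rewrite big_ord_recr /= mulrDl evD -E evZ -[shift _]/(iter k.+1 shift p) ev_shifts mulrA.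
  congr (_ * _ + _); apply: eq_bigr => i _; by rewrite coef_poly ltn_ord.
- apply: leq_trans (size_polyD _ _) _; rewrite geq_max (leq_trans sq) //=.
  apply: leq_trans (size_scale_leq _ _) _.
  by rewrite -[shift _]/(iter k.+1 shift p) -addnS; apply: size_shifts.
- by rewrite coefD coefZ coef_shifts (leq_sizeP _ _ sq) ?add0r.
Qed.

Lemma ev_mul_const p r : ev p * iota r = ev (\poly_(i < size p) (p`_i * iter i sigma r)).
Proof.
rewrite (ev_coef (leqnn _)) (ev_coef (size_poly _ _)) big_distrl /=.
apply: eq_bigr => i _; rewrite coef_poly ltn_ord rmorphM -!mulrA; congr (_ * _).
elim: (nat_of_ord i) => [|k IH] /=; first by rewrite expr0 mulr1 mul1r.
by rewrite exprS -mulrA IH mulrA xr -mulrA.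
Qed.

Section SemiprimeBase.
Hypotheses (sR : semiprime R) (accR : acc_lann R) (finR : finite_udim R).
Let ns : nonsingular R := semiprime_nonsingular sR accR.

Let iter_endo k : injective_endo (iter k sigma) := endo_iter k se.

(** For [ev p * f = 0] the top coefficient is that of [p] times the image under [sigma^m] of the one
    of [f], and injectivity suffices. For [f * ev p = 0] the coefficient of [p] is the one that is
    twisted, which requires [endo_regular]. *)
Lemma ev_regular p m : (size p <= m.+1)%N -> regular p`_m -> regular (ev p).
Proof.
move=> sp [rl rr]; split=> f; have [h ->] := ev_surj f => E.
  suff -> : h = 0 by rewrite ev0.
  apply/eqP; rewrite -lead_coef_eq0; apply/eqP.
  have [q [Eq _ cq]] := ev_mul_lead sp (leqSpred (size h)).
  apply: (endo_inj (iter_endo m)); apply: rl; rewrite lead_coefE -cq.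
  by rewrite (ev_eq0 (p := q)) ?coef0 // -Eq.
suff -> : h = 0 by rewrite ev0.
apply/eqP; rewrite -lead_coef_eq0; apply/eqP.
have [q [Eq _ cq]] := ev_mul_lead (leqSpred (size h)) sp.
have [_ Hr] := endo_regular sR accR finR (iter_endo (size h).-1) (conj rl rr).
apply: Hr; rewrite lead_coefE -cq.
by rewrite (ev_eq0 (p := q)) ?coef0 // -Eq.
Qed.

(** Pseudo-division: the leading coefficient of [x ^+ (N - m) * ev pg] is regular by [endo_regular]
    but not invertible, so the left Ore condition supplies the factor [s] on the dividend. *)
Lemma ev_division (pg : {poly R}) m : (size pg <= m.+1)%N -> regular pg`_m ->
  forall p, exists s (q : A) p', [/\ regular s, iota s * ev p = q * ev pg + ev p' &
    (size p' <= m)%N].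
Proof.
move=> sg rg p; move: {2}(size p) (leqnn (size p)) => N.
elim: N p => [|N IH] p sp.
  exists 1, 0, p; rewrite rmorph1 mul1r mul0r add0r; split=> //.
    by split=> a; rewrite ?mul1r ?mulr1.
  by apply: leq_trans sp _.
have [Nm|mN] := ltnP N m.
  exists 1, 0, p; rewrite rmorph1 mul1r mul0r add0r; split=> //.
    by split=> a; rewrite ?mul1r ?mulr1.
  by apply: leq_trans sp _.
have [s [t [rs Est]]] :=
  left_ore sR accR finR p`_N (endo_regular sR accR finR (iter_endo (N - m)) rg).
pose p1 := s *: p - t *: iter (N - m) shift pg.
have sp1 : (size p1 <= N)%N.
  apply/leq_sizeP => j; rewrite leq_eqVlt => /orP[/eqP <-|Nj].
    rewrite coefB !coefZ -{3}(subnK mN) coef_shifts Est subrr //.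
  rewrite coefB !coefZ (leq_sizeP _ _ sp) // mulr0 sub0r.
  have /leq_sizeP -> // : (size (iter (N - m) shift pg) <= N.+1)%N.
    by rewrite -{2}(subnK mN) -addnS; apply: size_shifts.
  by rewrite mulr0 oppr0.
have [s' [q [p' [rs' E sp']]]] := IH _ sp1.
exists (s' * s), (q + iota s' * iota t * x ^+ (N - m)), p'; split=> //.
  exact: regularM.
rewrite mulrDl addrAC -E rmorphM -!mulrA -ev_shifts -!evZ -evD -scalerDr.
by rewrite subrK.
Qed.

(* Otherwise [A f] meets [A g] trivially for some [f <> 0], and dividing the elements
   [x ^+ k * f] by [g] gives infinitely many independent polynomials of size at most
   [m], contradicting the finite uniform dimension of [R ^ m]. *)
Lemma essential_ev (pg : {poly R}) m : (size pg <= m.+1)%N -> regular pg`_m ->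
  essential (fun f => exists y, f = y * ev pg).
Proof.
move=> sg rg; apply: contrapT => /not_essentialP[f f0 Hf].
have [pf Ef] := ev_surj f.
have pf0 : pf != 0 by apply/eqP => E; apply: f0; rewrite Ef E ev0.
set d := (size pf).-1; have sf : (size pf <= d.+1)%N := leqSpred _.
have lead h k : (size h <= k.+1)%N -> (exists y, ev h * f = y * ev pg) ->
    h`_k * iter k sigma pf`_d = 0.
  move=> sh /Hf; rewrite Ef.
  by have [q [-> _ <-]] := ev_mul_lead sh sf => /ev_eq0 ->; rewrite coef0.
have step k : exists eqw : R * A * {poly R}, let: (e, q, w) := eqw in
    [/\ (size w <= m)%N, iota e * x ^+ k * f = q * ev pg + ev w, w <> 0 &
      forall r, r * (e * iter k sigma pf`_d) = 0 -> r *: w = 0].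
  have [s [q [v [rs E sv]]]] := ev_division sg rg (iter k shift pf).
  rewrite ev_shifts -Ef in E.
  have b0 : s * iter k sigma pf`_d <> 0.
    move=> /(proj1 rs)/(endo_inj (iter_endo k))/eqP; rewrite -lead_coefE.
    by rewrite lead_coef_eq0 (negbTE pf0).
  (* The factor [t] is chosen so that whatever kills the leading coefficient of [e * x ^+ k * f]
     already kills the remainder [w]. The independence of the remainders follows from this link. *)
  have [t t0 Ht] := nonsingular_elt ns b0.
  have Ew : iota (t * s) * x ^+ k * f = iota t * q * ev pg + ev (t *: v).
    by rewrite rmorphM -!mulrA E evZ mulrDr.
  exists (t * s, iota t * q, t *: v); split=> //.
  - by apply: leq_trans (size_scale_leq _ _) sv.
  - move=> w0; apply: t0; rewrite -[t]mul1r; apply: Ht; rewrite mul1r mulrA.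
    have := @lead ((t * s) *: 'X^k) k; rewrite coefZ coefXn eqxx mulr1; apply.
      by rewrite (leq_trans (size_scale_leq _ _)) // size_polyXn.
    exists (iota t * q); rewrite evZ /ev map_polyXn hornerXn.
    by rewrite Ew w0 ev0 addr0.
  - by move=> r; rewrite -(mulrA t) mulrA => /Ht; rewrite scalerA => ->; rewrite scale0r.
have /choice[g Hg] := step.
pose e k := (g k).1.1; pose q k := (g k).1.2; pose w k := (g k).2.
have {}Hg k : [/\ (size (w k) <= m)%N,
    iota (e k) * x ^+ k * f = q k * ev pg + ev (w k), w k <> 0 &
    forall r, r * (e k * iter k sigma pf`_d) = 0 -> r *: w k = 0].
  by have := Hg k; rewrite /w /e /q; case: (g k) => -[].
have evX r k : ev (r *: 'X^k) = iota r * x ^+ k.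
  by rewrite evZ /ev map_polyXn hornerXn.
apply: (@no_infinite_indep_poly R m finR); exists w => K; split; first by case: (Hg K).
elim: K => // K IH; rewrite mkseqS; apply/indep_rcons; split=> //; first by case: (Hg K).
move=> r Hr; have [_ EK _ HK] := Hg K; apply: HK.
(* A combination of earlier remainders equals [h * f] modulo [A g] with [h] of size at most [K].
   Subtracting it leaves the coefficient of [x ^+ K] unchanged, so [lead] applies to the
   difference. *)
have [h sh [y Eh]] : exists2 h : {poly R}, (size h <= K)%N &
    exists y, ev h * f = y * ev pg + ev (r *: w K).
  move: Hr; apply: (@in_span_least _ _ (fun z => exists2 h : {poly R}, (size h <= K)%N &
    exists y, ev h * f = y * ev pg + ev z)).
  - by exists 0; rewrite ?size_poly0 //; exists 0; rewrite ev0 !mul0r addr0.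
  - move=> u v [h sh [y Eh]] [h' sh' [y' Eh']]; exists (h + h').
      by rewrite (leq_trans (size_polyD _ _)) // geq_max sh.
    by exists (y + y'); rewrite !evD !mulrDl Eh Eh' addrACA.
  - move=> s u [h sh [y Eh]]; exists (s *: h).
      by rewrite (leq_trans (size_scale_leq _ _)).
    by exists (iota s * y); rewrite !evZ -!mulrA Eh mulrDr.
  - move=> z /mapP[i Hi ->]; have iK : (i < K)%N by move: Hi; rewrite mem_iota.
    have [_ Ei _ _] := Hg i; exists (e i *: 'X^i).
      by rewrite (leq_trans (size_scale_leq _ _)) // size_polyXn.
    by exists (q i); rewrite evX.
have := @lead ((r * e K) *: 'X^K - h) K.
rewrite coefB coefZ coefXn eqxx mulr1 (leq_sizeP _ _ sh) // subr0 -mulrA; apply.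
  rewrite (leq_trans (size_polyD _ _)) // geq_max size_polyN (leqW sh) andbT.
  by rewrite (leq_trans (size_scale_leq _ _)) // size_polyXn.
exists (iota r * q K - y); rewrite evB evX rmorphM !mulrBl Eh -!mulrA (mulrA (iota (e K))) EK.
by rewrite mulrDr -evZ opprD addrACA subrr addr0.
Qed.

Definition lead_ideal (E : A -> Prop) j a : Prop :=
  exists p, [/\ E (ev p), (size p <= j.+1)%N & p`_j = a].

Lemma lead_ideal_left E j : is_left_ideal E -> is_left_ideal (lead_ideal E j).
Proof.
move=> [E0 ED EZ]; split.
- by exists 0; rewrite ev0 coef0 size_poly0.
- move=> _ _ [p [Ep sp <-]] [q [Eq sq <-]]; exists (p + q).
  rewrite evD coefD; split=> //; first exact: ED.
  by rewrite (leq_trans (size_polyD _ _)) // geq_max sp.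
- move=> r _ [p [Ep sp <-]]; exists (r *: p); rewrite evZ coefZ; split=> //.
    exact: EZ.
  by rewrite (leq_trans (size_scale_leq _ _)).
Qed.

(* [E] meets every [A b ^+ n.+1], and multiplying by powers of [x] brings the resulting
   elements to a common degree [J], where their leading coefficients are nonzero
   multiples of the independent elements [sigma^J (b ^+ n.+1)]. *)
Lemma essential_lead_regular E : is_left_ideal E -> essential E ->
  exists m p, [/\ E (ev p), (size p <= m.+1)%N & regular p`_m].
Proof.
move=> lE eE; have [_ _ EZ] := lE.
have [||n [l [_ Ht Hess]]] := endo_family sR accR finR (I := fun _ => True); [by []| |].
  by move=> a a0; exists 1; rewrite mul1r.
have nz b : b \in l -> b ^+ n.+1 <> 0.
  move=> bl; have /triangular_indep/indep_neq0 := Ht _ (iter_endo 0%N); apply.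
  exact: (map_f (fun b => b ^+ n.+1)).
have [J HJ] : exists J, forall b, b \in l -> forall j, (J <= j)%N ->
    exists c, c * iter j sigma (b ^+ n.+1) <> 0 /\
      lead_ideal E j (c * iter j sigma (b ^+ n.+1)).
  elim: (l) nz => [|b s IH] nz; first by exists 0%N.
  have [|J HJ] := IH; first by move=> c cs; apply: nz; rewrite inE cs orbT.
  set b' := b ^+ n.+1.
  have ib : iota b' <> 0.
    move=> ib; apply: (nz b); rewrite ?mem_head //.
    by apply/eqP; rewrite -polyC_eq0; apply/eqP/ev_eq0; rewrite /ev map_polyC hornerC.
  have [f [f0 Ef]] := eE _ ib; have [p Ep] := ev_surj f.
  rewrite Ep ev_mul_const in f0 Ef; set q := \poly_(i < _) _ in f0 Ef.
  have q0 : q != 0 by apply/eqP => q0; apply: f0; rewrite q0 ev0.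
  exists (maxn J (size q).-1) => c; rewrite inE => /orP[/eqP ->|cs] j; last first.
    by rewrite geq_max => /andP[Jj _]; apply: HJ.
  rewrite geq_max => /andP[_ qj].
  elim: j qj => [|j IHj] qj.
    have sq : (size q <= 1)%N by rewrite (leq_trans (leqSpred _)) // ltnS.
    have q00 : q`_0 <> 0.
      by move=> E0; case/eqP: q0; rewrite (size1_polyC sq) E0.
    exists p`_0; rewrite -/b'.
    have Eq0 : q`_0 = p`_0 * b' by move: q00; rewrite coef_poly; case: ifP.
    by rewrite /= -Eq0; split=> //; exists q.
  move: qj; rewrite leq_eqVlt => /orP[/eqP Ej|]; last first.
    rewrite ltnS => /IHj[c' [c0 [h [Eh sh ch]]]]; exists (sigma c').
    rewrite /= -(endoM se); split; first by move=> /(endo_inj se).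
    exists (shift h); rewrite ev_shift coef_shift ch; split=> //; first exact: EZ.
    exact: size_shift.
  have qj0 : q`_j.+1 <> 0 by rewrite -Ej -lead_coefE; apply/eqP; rewrite lead_coef_eq0.
  exists p`_j.+1; rewrite -/b'.
  have Eqj : q`_j.+1 = p`_j.+1 * iter j.+1 sigma b'.
    by move: qj0; rewrite coef_poly; case: ifP.
  by rewrite -Eqj; split=> //; exists q; split=> //; rewrite -Ej leqSpred.
pose tau := iter J sigma.
have /choice[c Hc] : forall b, exists c, b \in l -> c * tau (b ^+ n.+1) <> 0 /\
    lead_ideal E J (c * tau (b ^+ n.+1)).
  move=> b; case: (boolP (b \in l)) => [bl|_]; last by exists 0.
  by have [c Hc] := HJ b bl J (leqnn _); exists c.
pose ws := [seq c b * tau (b ^+ n.+1) | b <- l].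
have iws : @indep R R^o ws.
  apply: (@indep_multiples R R^o _ l (fun b => tau (b ^+ n.+1)) c).
    by move=> b /Hc[].
  exact/triangular_indep/Ht/iter_endo.
have [L0 LD LZ] := lead_ideal_left J lE.
have eL : essential (lead_ideal E J).
  apply: essentialS (Hess ws iws (size_map _ _)) => a.
  by apply: (@in_span_least R R^o) => // _ /mapP[b /Hc[_ Lb] ->].
have [r [p [Ep sp <-]] rp] := essential_regular sR accR finR (lead_ideal_left J lE) eL.
by exists J, p.
Qed.

Lemma ore_nonsingular : nonsingular A.
Proof.
move=> b eb.
have [|m [p [Eb sp rp]]] := essential_lead_regular _ eb.
  split; first by rewrite mul0r.
    by move=> s t Hs Ht; rewrite mulrDl Hs Ht addr0.
  by move=> s t Ht; rewrite -mulrA Ht mulr0.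
exact: (proj1 (ev_regular sp rp)).
Qed.

(* For [J ^ 2 = 0] the right annihilator of [J] is an essential left ideal. *)
Lemma ore_semiprime : semiprime A.
Proof.
move=> J [[J0 JD JZ] [_ _ JR]] JJ a Ja.
pose N f := forall y, J y -> y * f = 0.
have lN : is_left_ideal N.
  split; first by move=> y; rewrite mulr0.
    by move=> f g Nf Ng y Jy; rewrite mulrDr Nf // Ng // addr0.
  by move=> r f Nf y Jy; rewrite mulrA Nf //; apply: JR.
have [|m [p [Np sp rp]]] := essential_lead_regular lN.
  move=> f f0; have [Nf|nNf] := pselect (N f); first by exists 1; rewrite mul1r.
  have [y [Jy yf]] : exists y, J y /\ y * f <> 0.
    apply: contrapT => ny; apply: nNf => y Jy; apply: contrapT => yf; apply: ny.
    by exists y.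
  by exists y; split=> // z Jz; apply: JJ => //; apply: JR.
by apply: (proj2 (ev_regular sp rp)); apply: Np.
Qed.

(** Let [E] be the span of an infinite independent sequence and [K] a complement. Some
    [ev p = f + k] with regular leading coefficient lies in [E + K], with [f] in the span of the
    first [m] terms. As [A (ev p)] is essential, it contains a nonzero [r * u m = y * f + y * k];
    then [y * k] lies in both [E] and [K], hence vanishes, and [r * u m] depends on the first [m]
    terms. *)
Lemma ore_finite_udim : finite_udim A.
Proof.
move=> [u Hu].
pose E f := exists m, @in_span A A^o (mkseq u m) f.
have Emono m k f : (m <= k)%N -> @in_span A A^o (mkseq u m) f -> @in_span A A^o (mkseq u k) f.
  by move=> mk; apply: in_span_sub => _ /mapP[i Hi ->]; apply: map_f;
    move: Hi; rewrite !mem_iota /= !add0n => /leq_trans; apply.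
have lE : is_left_ideal E.
  split; first by exists 0%N.
    move=> f g [m Hf] [k Hg]; exists (maxn m k); apply: (@in_spanD A A^o).
      by apply: Emono Hf; apply: leq_maxl.
    by apply: Emono Hg; apply: leq_maxr.
  by move=> r f [m Hf]; exists m; apply: (@in_spanZ A A^o).
have [K [lK EK eEK]] := left_complement lE.
have [[E0 ED EZ] [K0 KD KZ]] := (lE, lK).
have [|n [p [[f [k [[m Hf] Kk Ep]]] sp rp]]] := essential_lead_regular _ eEK.
  split; first by exists 0, 0; rewrite addr0.
    move=> _ _ [e [k [Ee Kk ->]]] [e' [k' [Ee' Kk' ->]]]; exists (e + e'), (k + k').
    by rewrite addrACA; split=> //; [apply: ED|apply: KD].
  move=> r _ [e [k [Ee Kk ->]]]; exists (r * e), (r * k).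
  by rewrite mulrDr; split=> //; [apply: EZ|apply: KZ].
have [_] := Hu m.+1; rewrite mkseqS => /indep_rcons[_ um0 Hum].
have [r [r0 [y Ey]]] := essential_ev sp rp um0.
apply: r0; apply: (Hum r); rewrite -[_ *: _]/(r * u m) Ey Ep mulrDr.
have yk : y * k = 0.
  apply: EK; last exact: KZ.
  have -> : y * k = r * u m - y * f by rewrite Ey Ep mulrDr addrC addKr.
  rewrite -mulN1r; apply: ED; last by apply: (EZ (-1)); apply: EZ; exists m.
  apply: EZ; exists m.+1; apply: in_span_mem.
  by rewrite mkseqS mem_rcons mem_head.
by rewrite yk addr0; apply: (@in_spanZ A A^o).
Qed.

End SemiprimeBase.

Theorem ore_semiprime_Goldie : semiprime R /\ left_Goldie R ->
  semiprime A /\ left_Goldie A.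
Proof.
move=> [sR [accR /finite_left_udimP finR]].
have fA := ore_finite_udim sR accR finR.
split; first exact: ore_semiprime.
split; last exact/finite_left_udimP.
by apply: nonsingular_acc_lann => //; apply: ore_nonsingular.
Qed.

End OreExtension.

(** * The classical left quotient ring *)

Section Germs.
Local Open Scope quotient_scope.
Variable R : nzRingType.
Implicit Types (I J D : R -> Prop) (a b c r : R).

(* Left linear maps act on the right of their arguments, so the product [germ_mul f g]
   below is "first [f], then [g]". *)
Record germ : Type := Germ {
  gdom : R -> Prop;
  gfun :> R -> R;
  gdom_ideal : is_left_ideal gdom;
  gdom_essential : essential gdom;
  germD : forall a b, gdom a -> gdom b -> gfun (a + b) = gfun a + gfun b;
  germZ : forall r a, gdom a -> gfun (r * a) = r * gfun a }.
Implicit Types (f g h : germ).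

HB.instance Definition _ := gen_eqMixin germ.
HB.instance Definition _ := gen_choiceMixin germ.

(** The quotient is the direct limit of the groups [Hom(D, R)] over the essential left ideals [D];
    for nonsingular [R] this is the maximal left quotient ring. It is the classical one here because
    every essential left ideal contains a regular element. *)
Definition germ_eq f g : bool :=
  `[< exists D, [/\ is_left_ideal D, essential D &
        forall a, D a -> [/\ gdom f a, gdom g a & f a = g a]] >].

Lemma lidealI I J : is_left_ideal I -> is_left_ideal J ->
  is_left_ideal (fun a => I a /\ J a).
Proof.
move=> [I0 ID IZ] [J0 JD JZ]; split=> // [a b [Ia Ja] [Ib Jb]|r a [Ia Ja]].
  by split; [apply: ID|apply: JD].
by split; [apply: IZ|apply: JZ].
Qed.

Lemma germ_eq_ext f g :
  (forall a, gdom f a -> gdom g a -> f a = g a) -> germ_eq f g.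
Proof.
move=> fg; apply/asboolP; exists (fun a => gdom f a /\ gdom g a); split.
- exact: lidealI (gdom_ideal f) (gdom_ideal g).
- exact: essentialI (gdom_ideal f) (gdom_essential f) (gdom_essential g).
- by move=> a [fa ga]; split=> //; apply: fg.
Qed.

Lemma germ_eq_refl : reflexive germ_eq.
Proof. by move=> f; apply: germ_eq_ext. Qed.

Lemma germ_eq_sym : symmetric germ_eq.
Proof.
suff H f g : germ_eq f g -> germ_eq g f by move=> f g; apply/idP/idP; apply: H.
move=> /asboolP[D [lD eD HD]]; apply/asboolP; exists D; split=> // a /HD[] //.
Qed.

Lemma germ_eq_trans : transitive germ_eq.
Proof.
move=> g f h /asboolP[D [lD eD HD]] /asboolP[D' [lD' eD' HD']]; apply/asboolP.
exists (fun a => D a /\ D' a); split; first exact: lidealI.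
  exact: essentialI.
by move=> a [/HD[fa _ ->] /HD'[_ ha ->]].
Qed.

Canonical germ_equiv := EquivRel germ_eq germ_eq_refl germ_eq_sym germ_eq_trans.

Definition germs := {eq_quot germ_eq}.

HB.instance Definition _ := Choice.on germs.
HB.instance Definition _ := EqQuotient.on germs.

Lemma gdom0 f : gdom f 0. Proof. by case: (gdom_ideal f). Qed.

Lemma germ0 f : f 0 = 0.
Proof. by rewrite -[in LHS](mul0r 0) germZ ?mul0r //; apply: gdom0. Qed.

Lemma lideal_preimage f D D' : is_left_ideal D -> is_left_ideal D' ->
  (forall a, D a -> gdom f a) -> is_left_ideal (fun a => D a /\ D' (f a)).
Proof.
move=> [D0 DD DZ] [D0' DD' DZ'] sub; split.
- by rewrite germ0.
- move=> a b [Da Da'] [Db Db']; split; first exact: DD.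
  by rewrite germD; [apply: DD'|apply: sub|apply: sub].
- by move=> r a [Da Da']; split; [apply: DZ|rewrite germZ; [apply: DZ'|apply: sub]].
Qed.

Lemma essential_preimage f D D' : is_left_ideal D -> is_left_ideal D' ->
  (forall a, D a -> gdom f a) -> essential D -> essential D' ->
  essential (fun a => D a /\ D' (f a)).
Proof.
move=> [D0 DD DZ] [D0' DD' DZ'] sub eD eD' a /eD[r [ra Dra]].
have [fra|fra] := pselect (f (r * a) = 0); first by exists r; rewrite fra.
have [s [s0 Ds]] := eD' _ fra; exists (s * r); rewrite -mulrA.
rewrite germZ; last exact: sub.
split; last by split=> //; apply: DZ.
by move=> E; apply: s0; rewrite -germZ; [rewrite E germ0|apply: sub].
Qed.

Let lidealT : is_left_ideal (fun _ : R => True).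
Proof. by []. Qed.

Let essentialT : essential (fun _ : R => True).
Proof. by move=> a a0; exists 1; rewrite mul1r. Qed.

Definition germ_right_mul c : germ :=
  @Germ _ (fun a => a * c) lidealT essentialT
    (fun a b _ _ => mulrDl a b c) (fun r a _ => esym (mulrA r a c)).

Let germ_addD f g a b : gdom f a /\ gdom g a -> gdom f b /\ gdom g b ->
  f (a + b) + g (a + b) = (f a + g a) + (f b + g b).
Proof. by move=> [fa ga] [fb gb]; rewrite !germD // addrACA. Qed.

Let germ_addZ f g r a : gdom f a /\ gdom g a -> f (r * a) + g (r * a) = r * (f a + g a).
Proof. by move=> [fa ga]; rewrite !germZ // mulrDr. Qed.

Definition germ_add f g : germ :=
  @Germ _ _ (lidealI (gdom_ideal f) (gdom_ideal g))
    (essentialI (gdom_ideal f) (gdom_essential f) (gdom_essential g))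
    (@germ_addD f g) (@germ_addZ f g).

Let germ_oppD f a b : gdom f a -> gdom f b -> - f (a + b) = - f a + - f b.
Proof. by move=> fa fb; rewrite germD // opprD. Qed.

Let germ_oppZ f r a : gdom f a -> - f (r * a) = r * - f a.
Proof. by move=> fa; rewrite germZ // mulrN. Qed.

Definition germ_opp f : germ :=
  @Germ _ _ (gdom_ideal f) (gdom_essential f) (@germ_oppD f) (@germ_oppZ f).

Let germ_mulD f g a b : gdom f a /\ gdom g (f a) -> gdom f b /\ gdom g (f b) ->
  g (f (a + b)) = g (f a) + g (f b).
Proof. by move=> [fa ga] [fb gb]; rewrite !germD. Qed.

Let germ_mulZ f g r a : gdom f a /\ gdom g (f a) -> g (f (r * a)) = r * g (f a).
Proof. by move=> [fa ga]; rewrite !germZ. Qed.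

Definition germ_mul f g : germ :=
  @Germ _ _ (lideal_preimage (gdom_ideal f) (gdom_ideal g) (fun _ => id))
    (essential_preimage (gdom_ideal f) (gdom_ideal g) (fun _ => id)
      (gdom_essential f) (gdom_essential g)) (@germ_mulD f g) (@germ_mulZ f g).

Lemma germ_add_eq f f' g g' : germ_eq f f' -> germ_eq g g' ->
  germ_eq (germ_add f g) (germ_add f' g').
Proof.
move=> /asboolP[D [lD eD HD]] /asboolP[D' [lD' eD' HD']]; apply/asboolP.
exists (fun a => D a /\ D' a); split; first exact: lidealI.
  exact: essentialI.
by move=> a [/HD[fa fa' Ef] /HD'[ga ga' Eg]]; split=> //=; rewrite Ef Eg.
Qed.

Lemma germ_opp_eq f f' : germ_eq f f' -> germ_eq (germ_opp f) (germ_opp f').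
Proof.
move=> /asboolP[D [lD eD HD]]; apply/asboolP; exists D; split=> // a /HD[fa fa' Ef].
by split=> //=; rewrite Ef.
Qed.

Lemma germ_mul_eq f f' g g' : germ_eq f f' -> germ_eq g g' ->
  germ_eq (germ_mul f g) (germ_mul f' g').
Proof.
move=> /asboolP[D [lD eD HD]] /asboolP[D' [lD' eD' HD']]; apply/asboolP.
exists (fun a => D a /\ D' (f a)); split.
- by apply: lideal_preimage => // a /HD[].
- by apply: essential_preimage => // a /HD[].
- by move=> a [/HD[fa fa' Ef] /HD'[ga ga' Eg]]; split=> /=; rewrite -?Ef.
Qed.

Implicit Types X Y Z : germs.

Lemma germ_repr f : germ_eq (repr (\pi_germs f)) f.
Proof. by apply/eqmodP; rewrite reprK. Qed.

Definition germs_add X Y : germs := \pi_germs (germ_add (repr X) (repr Y)).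
Definition germs_opp X : germs := \pi_germs (germ_opp (repr X)).
Definition germs_mul X Y : germs := \pi_germs (germ_mul (repr X) (repr Y)).
Definition germs_of c : germs := \pi_germs (germ_right_mul c).

Lemma germs_addE f g : germs_add (\pi_germs f) (\pi_germs g) = \pi_germs (germ_add f g).
Proof. by apply/eqmodP/germ_add_eq; apply: germ_repr. Qed.

Lemma germs_oppE f : germs_opp (\pi_germs f) = \pi_germs (germ_opp f).
Proof. by apply/eqmodP/germ_opp_eq; apply: germ_repr. Qed.

Lemma germs_mulE f g : germs_mul (\pi_germs f) (\pi_germs g) = \pi_germs (germ_mul f g).
Proof. by apply/eqmodP/germ_mul_eq; apply: germ_repr. Qed.

Lemma germs_ext f g : (forall a, gdom f a -> gdom g a -> f a = g a) ->
  \pi_germs f = \pi_germs g.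
Proof. by move=> fg; apply/eqmodP/germ_eq_ext. Qed.

Let addA : associative germs_add.
Proof.
elim/quotW => f; elim/quotW => g; elim/quotW => h.
rewrite (germs_addE g h) (germs_addE f g) !germs_addE.
by apply: germs_ext => a _ _ /=; rewrite addrA.
Qed.

Let addC : commutative germs_add.
Proof.
elim/quotW => f; elim/quotW => g; rewrite !germs_addE.
by apply: germs_ext => a _ _ /=; rewrite addrC.
Qed.

Let add0 : left_id (germs_of 0) germs_add.
Proof.
elim/quotW => f; rewrite germs_addE.
by apply: germs_ext => a _ _ /=; rewrite mulr0 add0r.
Qed.

Let addN : left_inverse (germs_of 0) germs_opp germs_add.
Proof.
elim/quotW => f; rewrite germs_oppE germs_addE.
by apply: germs_ext => a _ _ /=; rewrite mulr0 addNr.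
Qed.

HB.instance Definition _ := GRing.isZmodule.Build germs addA addC add0 addN.

Let mulA : associative germs_mul.
Proof.
elim/quotW => f; elim/quotW => g; elim/quotW => h.
rewrite (germs_mulE g h) (germs_mulE f g) !germs_mulE.
by apply: germs_ext.
Qed.

Let mul1 : left_id (germs_of 1) germs_mul.
Proof.
elim/quotW => f; rewrite germs_mulE.
by apply: germs_ext => a _ _ /=; rewrite mulr1.
Qed.

Let mul1' : right_id (germs_of 1) germs_mul.
Proof.
elim/quotW => f; rewrite germs_mulE.
by apply: germs_ext => a _ _ /=; rewrite mulr1.
Qed.

Let mulD : left_distributive germs_mul germs_add.
Proof.
elim/quotW => f; elim/quotW => g; elim/quotW => h.
rewrite (germs_addE f g) !germs_mulE germs_addE.
apply: germs_ext => a /= [[fa ga] _] [[_ hf] [_ hg]].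
by rewrite germD.
Qed.

Let mulD' : right_distributive germs_mul germs_add.
Proof.
elim/quotW => f; elim/quotW => g; elim/quotW => h.
by rewrite (germs_addE g h) !germs_mulE germs_addE; apply: germs_ext.
Qed.

Let one_neq0 : germs_of 1 != germs_of 0.
Proof.
apply/eqP => /eqmodP/asboolP[D [_ eD HD]].
have [|r [r0 /HD[_ _ /=]]] := eD 1; first exact/eqP/oner_neq0.
by rewrite mulr0 mulr1.
Qed.

HB.instance Definition _ :=
  GRing.Zmodule_isNzRing.Build germs mulA mul1 mul1' mulD mulD' one_neq0.

Lemma germs_of_zmod : zmod_morphism germs_of.
Proof.
move=> a b; rewrite -[RHS]/(germs_add (\pi_germs _) (germs_opp (\pi_germs _))).
rewrite germs_oppE germs_addE; apply: germs_ext => c _ _ /=.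
by rewrite mulrBr.
Qed.

Lemma germs_of_monoid : monoid_morphism germs_of.
Proof.
split=> // a b; rewrite -[RHS]/(germs_mul (\pi_germs _) (\pi_germs _)) germs_mulE.
by apply: germs_ext => c _ _ /=; rewrite mulrA.
Qed.

HB.instance Definition _ := GRing.isZmodMorphism.Build R germs germs_of germs_of_zmod.
HB.instance Definition _ := GRing.isMonoidMorphism.Build R germs germs_of germs_of_monoid.

End Germs.

Section LeftQuotient.
Local Open Scope quotient_scope.
Variable R : nzRingType.
Hypotheses (sR : semiprime R) (accR : acc_lann R) (finR : finite_udim R).
Let ns : nonsingular R := semiprime_nonsingular sR accR.

Lemma germs_of_inj : injective (@germs_of R).
Proof.
move=> a b /eqmodP/asboolP[D [_ eD HD]]; apply/eqP; rewrite -subr_eq0; apply/eqP.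
apply: ns; apply: essentialS eD => r /HD[_ _ /= E].
by rewrite mulrBr E subrr.
Qed.

(** The inverse is the germ [y * s |-> y], defined on the essential left ideal [R s]. *)
Lemma germs_of_regular (s : R) : regular s -> invertible (germs_of s).
Proof.
move=> [_ sr].
pose D a := exists y, a = y * s.
have /choice[g Hg] : forall a, exists y, D a -> a = y * s.
  by move=> a; have [[y ->]|nD] := pselect (D a); [exists y|exists 0].
have {}Hg y : g (y * s) = y.
  apply/eqP; rewrite -subr_eq0; apply/eqP/sr; rewrite mulrBl -Hg ?subrr //.
  by exists y.
have lD : is_left_ideal D.
  split; first by exists 0; rewrite mul0r.
    by move=> _ _ [y ->] [z ->]; exists (y + z); rewrite mulrDl.
  by move=> r _ [y ->]; exists (r * y); rewrite mulrA.
have gD a b : D a -> D b -> g (a + b) = g a + g b.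
  by move=> [y ->] [z ->]; rewrite -mulrDl !Hg.
have gZ r a : D a -> g (r * a) = r * g a by move=> [y ->]; rewrite mulrA !Hg.
pose gg := Germ lD (essential_principal finR sr) gD gZ.
exists (\pi_(germs R) gg); split;
  rewrite -[LHS]/(germs_mul (\pi_(germs R) _) (\pi_(germs R) _)) germs_mulE.
  by apply: germs_ext => a _ _ /=; rewrite mulr1 Hg.
by apply: germs_ext => a [[y /= Ea] _] _ /=; rewrite Ea Hg mulr1.
Qed.

Lemma germs_fraction (q : germs R) : exists s a,
  regular s /\ germs_of s * q = germs_of a.
Proof.
elim/quotW: q => f.
have [s ds rs] := essential_regular sR accR finR (gdom_ideal f) (gdom_essential f).
exists s, (f s); split=> //.
rewrite -[LHS]/(germs_mul (\pi_(germs R) _) (\pi_(germs R) _)) germs_mulE.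
by apply: germs_ext => a _ _ /=; rewrite germZ.
Qed.

Lemma germs_left_total_quotient :
  is_left_total_quotient (@germs_of R : {rmorphism R -> germs R}).
Proof.
split; [exact: germs_of_inj|exact: germs_of_regular|exact: germs_fraction].
Qed.

(* With [s = l + k] regular, [l] in [L] and [k] in a complement of [L] in [R], the
   element [s^-1 l] is a right identity of [L]. *)
Lemma germs_semisimple : semisimple (germs R).
Proof.
move=> L [L0 LD LZ]; pose phi : {rmorphism R -> germs R} := @germs_of R.
pose L1 a := L (phi a).
have lL1 : is_left_ideal L1.
  split=> [|a b|r a]; rewrite /L1; first by rewrite rmorph0.
    by rewrite rmorphD; apply: LD.
  by rewrite rmorphM; apply: LZ.
have [K [lK LK eLK]] := left_complement lL1.
have [[E0 ED EZ] [K0 KD KZ]] := (lL1, lK).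
have [|s [l [k [Ll Kk Es]]] rs] := essential_regular sR accR finR _ eLK.
  split; first by exists 0, 0; rewrite addr0.
    move=> _ _ [e [m [Ee Km ->]]] [e' [m' [Ee' Km' ->]]]; exists (e + e'), (m + m').
    by rewrite addrACA; split=> //; [apply: ED|apply: KD].
  move=> r _ [e [m [Ee Km ->]]]; exists (r * e), (r * m).
  by rewrite mulrDr; split=> //; [apply: EZ|apply: KZ].
have [t [st ts]] := germs_of_regular rs.
pose e := t * phi l; have Le : L e by apply: LZ.
have e1 : 1 - e = t * phi k.
  by rewrite -ts -/phi -[germs_of s]/(phi s) Es rmorphD mulrDr addrAC subrr add0r.
have qe q : L q -> q = q * e.
  move=> Lq; apply/eqP; rewrite -subr_eq0 -{1}[q]mulr1 -mulrBr e1 mulrA.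
  (* It remains to see that [q * t * phi k = 0]. Clearing the denominator of [q * t] by [s'] turns
     this element into [phi (b * k)], and [b * k] lies in both [L1] and [K]. *)
  have [s' [b [rs' Eb]]] := germs_fraction (q * t).
  have [t' [_ ts']] := germs_of_regular rs'.
  have Lz : L (q * t * phi k).
    rewrite -mulrA -e1 mulrBr mulr1 -mulN1r; apply: LD => //.
    by apply: (LZ (-1)); apply: LZ.
  have Ebk : phi (b * k) = phi s' * (q * t * phi k) by rewrite rmorphM mulrA Eb.
  have bk0 : b * k = 0.
    apply: LK; last exact: KZ.
    by rewrite /L1 Ebk; apply: LZ.
  have -> : q * t * phi k = t' * (phi s' * (q * t * phi k)) by rewrite mulrA ts' mul1r.
  by rewrite -Ebk bk0 rmorph0 mulr0.
exists (fun q => q * e = 0); split.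
- split=> [|a b Ha Hb|r a Ha]; first by rewrite mul0r.
    by rewrite mulrDl Ha Hb addr0.
  by rewrite -mulrA Ha mulr0.
- move=> q; exists (q * e), (q - q * e); split; first exact: LZ.
    by rewrite mulrBl -mulrA -(qe e) // subrr.
  by rewrite addrC subrK.
- by move=> q /qe {2}->.
Qed.

End LeftQuotient.

Theorem left_Goldie_quotient (R : nzRingType) : semiprime R -> left_Goldie R ->
  Ql_exists_semisimple R.
Proof.
move=> sR [accR /finite_left_udimP finR].
exists (germs R), (@germs_of R : {rmorphism R -> germs R}); split.
  exact: germs_left_total_quotient.
exact: germs_semisimple.
Qed.

(** * Converse rings *)

Section SemisimpleConverse.
Variable Q : nzRingType.
Hypothesis ssQ : semisimple Q.

Lemma semisimple_left_ideal L : is_left_ideal L ->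
  exists e : Q, L e /\ forall q, L q -> q = q * e.
Proof.
move=> lL; have [L' [[L0' LD' LZ'] cov disj]] := ssQ lL.
have [L0 LD LZ] := lL.
have [e [f [Le Lf E1]]] := cov 1; exists e; split=> // q Lq.
have Eq : q - q * e = q * f.
  by rewrite -{1}[q]mulr1 E1 mulrDr addrAC subrr add0r.
apply/eqP; rewrite -subr_eq0; apply/eqP; apply: disj; last by rewrite Eq; apply: LZ'.
by apply: LD => //; rewrite -mulN1r; apply: (LZ (-1)); apply: LZ.
Qed.

Lemma semisimple_von_neumann (q : Q) : exists p, q = q * p * q.
Proof.
have [|_ [[p ->] He]] := @semisimple_left_ideal (fun a => exists p, a = p * q).
  split; first by exists 0; rewrite mul0r.
    by move=> _ _ [p ->] [p' ->]; exists (p + p'); rewrite mulrDl.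
  by move=> r _ [p ->]; exists (r * p); rewrite mulrA.
by exists p; rewrite -mulrA; apply: He; exists 1; rewrite mul1r.
Qed.

(** The left ideals [Q (e k)] increase. Their union has a right identity lying in one of them, so
    the chain stops there. *)
Lemma no_infinite_orthogonal_idempotents (e h : nat -> Q) :
  (forall k, e k.+1 = e k + h k) -> (forall k, e k * e k = e k) ->
  (forall k, e k * h k = 0) -> (forall k, h k * e k = 0) -> exists k, h k = 0.
Proof.
move=> eS eK eh he; pose L a := exists k, a = a * e k.
have step k a : a = a * e k -> a = a * e k.+1.
  by move=> E; rewrite E -mulrA eS mulrDr eK eh addr0.
have mono m k a : (m <= k)%N -> a = a * e m -> a = a * e k.
  by move=> /subnKC <-; elim: (k - m)%N => [|i IH]; rewrite ?addn0 // addnS => /IH/step.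
have [|g [[k Eg] Hg]] := @semisimple_left_ideal L.
  split; first by exists 0%N; rewrite mul0r.
    move=> a b [i Ei] [j Ej]; exists (maxn i j); rewrite mulrDl.
    by rewrite -(mono _ _ _ (leq_maxl i j) Ei) -(mono _ _ _ (leq_maxr i j) Ej).
  by move=> r a [i Ei]; exists i; rewrite -mulrA -Ei.
exists k; have Lk : L (e k.+1) by exists k.+1.
have E2 : e k.+1 = e k.+1 * e k by rewrite {1}(Hg _ Lk) Eg mulrA -(Hg _ Lk).
by move: E2; rewrite {2}eS mulrDl eK he addr0 eS -{2}[e k]addr0 => /addrI.
Qed.

(** If an idempotent [e] of [I] is not a left identity of [I], then [y = q - e * q] is nonzero for
    some [q] in [I], and von Neumann regularity turns [y] into an idempotent that enlarges [e].
    Repeating this from [0] would give infinitely many nonzero orthogonal idempotents. *)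
Lemma semisimple_right_ideal I : is_right_ideal I ->
  exists e : Q, I e /\ forall q, I q -> q = e * q.
Proof.
move=> [I0 ID IZ]; apply: contrapT => ne.
have IN a : I a -> I (- a) by rewrite -mulrN1; apply: IZ.
have /choice[h Hh] : forall e, exists h, I e -> e * e = e ->
    [/\ I h, h * h = h, e * h = 0, h * e = 0 & h <> 0].
  move=> e; have [[Ie ee]|nIe] := pselect (I e /\ e * e = e); last first.
    by exists 0 => Ie ee; case: nIe.
  have [q [Iq qe]] : exists q, I q /\ q <> e * q.
    apply: contrapT => nq; apply: ne; exists e; split=> // q Iq.
    by apply: contrapT => qe; apply: nq; exists q.
  pose y := q - e * q; have [p Ep] := semisimple_von_neumann y.
  have Iy : I y by apply: ID => //; apply/IN/IZ.
  have ey : e * y = 0 by rewrite mulrBr mulrA ee subrr.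
  have y0 : y <> 0 by move=> /eqP; rewrite subr_eq0 => /eqP.
  have [g [Ig gg eg Ey]] : exists g, [/\ I g, g * g = g, e * g = 0 & y = g * y].
    exists (y * p); rewrite !mulrA ey mul0r -Ep; split=> //; exact: IZ.
  (* The idempotent [g] satisfies [e * g = 0] only; the factor [1 - e] on the right makes the
     orthogonality two-sided, so that [e + h] is again idempotent. *)
  exists (g - g * e) => _ _; split.
  - by apply: ID; [|apply/IN/IZ].
  - by rewrite mulrBl !mulrBr !mulrA gg -(mulrA g e g) eg mulr0 mul0r !subr0.
  - by rewrite mulrBr mulrA eg mul0r subrr.
  - by rewrite mulrBl -mulrA ee subrr.
  - move=> E; apply: y0; rewrite Ey -gg.
    have -> : g * g = (g - g * e) * g by rewrite mulrBl -(mulrA g e) eg mulr0 subr0.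
    by rewrite E !mul0r.
pose u k := iter k (fun e => e + h e) 0.
have Hu k : I (u k) /\ u k * u k = u k.
  elim: k => [|k [Ik uk]] /=; first by rewrite mulr0.
  have [Ih hh eh he _] := Hh _ Ik uk; split; first exact: ID.
  by rewrite mulrDl !mulrDr uk hh eh he addr0 add0r.
have Hk k := Hh _ (proj1 (Hu k)) (proj2 (Hu k)).
have [//|k|k|k|k hk0] := @no_infinite_orthogonal_idempotents u (fun k => h (u k)).
- by case: (Hu k).
- by case: (Hk k).
- by case: (Hk k).
- by case: (Hk k).
Qed.

Lemma semisimple_converse : semisimple Q^c.
Proof.
move=> I [I0 ID IZ].
have [|e [Ie He]] := @semisimple_right_ideal I; first by split.
exists (fun q : Q => e * q = 0); split.
- split=> [|a b Ha Hb|r a Ha]; first by rewrite mulr0.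
    by rewrite mulrDr Ha Hb addr0.
  by rewrite -[r * a]/((a : Q) * (r : Q)) mulrA Ha mul0r.
- move=> q; exists ((e : Q) * (q : Q)), ((q : Q) - e * q); split.
  + exact: IZ.
  + by rewrite mulrBr mulrA -(He e) // subrr.
  + by rewrite addrC subrK.
- by move=> q /He {2}-> .
Qed.

End SemisimpleConverse.

Section ConverseMorphism.
Variables (R A : nzRingType).

Definition converse_fun (f : {rmorphism R -> A}) : R^c -> A^c := f.

Lemma converse_fun_zmod f : zmod_morphism (converse_fun f).
Proof. exact: (rmorphB f). Qed.

Lemma converse_fun_monoid f : monoid_morphism (converse_fun f).
Proof. by split=> [|a b]; [apply: (rmorph1 f)|apply: (rmorphM f b a)]. Qed.

HB.instance Definition _ f :=
  GRing.isZmodMorphism.Build R^c A^c (converse_fun f) (converse_fun_zmod f).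
HB.instance Definition _ f :=
  GRing.isMonoidMorphism.Build R^c A^c (converse_fun f) (converse_fun_monoid f).

Definition converse_cofun (f : {rmorphism R^c -> A}) : R -> A^c := f.

Lemma converse_cofun_zmod f : zmod_morphism (converse_cofun f).
Proof. exact: (rmorphB f). Qed.

Lemma converse_cofun_monoid f : monoid_morphism (converse_cofun f).
Proof. by split=> [|a b]; [apply: (rmorph1 f)|apply: (rmorphM f b a)]. Qed.

HB.instance Definition _ f :=
  GRing.isZmodMorphism.Build R A^c (converse_cofun f) (converse_cofun_zmod f).
HB.instance Definition _ f :=
  GRing.isMonoidMorphism.Build R A^c (converse_cofun f) (converse_cofun_monoid f).

End ConverseMorphism.

Lemma regular_converse (A : nzRingType) (s : A) :
  @regular A s <-> @regular A^c s.
Proof. by split=> -[H1 H2]; split. Qed.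

Theorem right_Goldie_quotient (A : nzRingType) : semiprime A^c -> left_Goldie A^c ->
  Qr_exists_semisimple A.
Proof.
move=> sA gA; have [Q [phi [[inj reg frac] ssQ]]] := left_Goldie_quotient sA gA.
exists Q^c, (converse_cofun phi : {rmorphism A -> Q^c}); split; last exact: semisimple_converse.
split=> //.
  by move=> s /regular_converse/reg[t [H1 H2]]; exists t.
by move=> q; have [s [a [/regular_converse rs E]]] := frac q; exists s, a.
Qed.

Lemma semiprime_converse (A : nzRingType) : semiprime A <-> semiprime A^c.
Proof.
split=> sA J [JL JR] JJ; apply: (sA J); first by split.
- by move=> a b Ja Jb; apply: (JJ b a).
- by split.
- by move=> a b Ja Jb; apply: (JJ b a).
Qed.

(** Base case of the inductions: without variables [iota] is bijective. *)
Lemma semiprime_Goldie_iso (R A : nzRingType) (f : {rmorphism R -> A}) :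
  injective f -> (forall a, exists r, a = f r) ->
  semiprime R /\ left_Goldie R -> semiprime A /\ left_Goldie A.
Proof.
move=> inj surj [sR [accR finR]].
have lI I : is_left_ideal I -> is_left_ideal (fun r => I (f r)).
  move=> [I0 ID IZ]; split; first by rewrite rmorph0.
    by move=> a b Ia Ib; rewrite rmorphD; apply: ID.
  by move=> r a Ia; rewrite rmorphM; apply: IZ.
split; last split.
- move=> J [lJ [J0 JD JZ]] JJ a; have [r ->] := surj a => Jr.
  suff -> : r = 0 by rewrite rmorph0.
  apply: (sR (fun r => J (f r))) => //.
    split; first exact: lI.
    split; first by rewrite rmorph0.
      by move=> b c Jb Jc; rewrite rmorphD; apply: JD.
    by move=> b c Jc; rewrite rmorphM; apply: JZ.
  by move=> b c Jb Jc; apply: inj; rewrite rmorphM rmorph0; apply: JJ.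
- move=> F FL FS; have [|k r|N HN] := accR (fun k r => F k (f r)).
  + move=> k; have [S HS] := FL k; exists (fun s => S (f s)) => r; split.
      by move=> /HS Fr s Ss; apply: inj; rewrite rmorphM rmorph0; apply: Fr.
    move=> Hr; apply/HS => s; have [t ->] := surj s => St.
    by rewrite -rmorphM Hr // rmorph0.
  + exact: FS.
  + by exists N => k Nk a; have [r ->] := surj a; apply: HN.
move=> [I [LI nzI iI]]; apply: finR; exists (fun k r => I k (f r)); split.
- by move=> k; apply: lI.
- move=> k; have [a [Ia a0]] := nzI k; have [r Er] := surj a; exists r.
  by rewrite -Er; split=> // r0; apply: a0; rewrite Er r0 rmorph0.
move=> m a Ia E i im; apply: inj; rewrite rmorph0.
by apply: (iI m (fun i => f (a i))) => //; rewrite -rmorph_sum E rmorph0.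
Qed.

(** * Ore extensions over converse rings *)

Section OreConverse.
Variables (R A : nzRingType) (iota : {rmorphism R -> A}) (x : A) (sigma tau : R -> R).
Hypotheses (se : injective_endo sigma) (xr : forall r, x * iota r = iota (sigma r) * x).
Hypotheses (ev_surj : forall f, exists p, f = ev iota x p)
  (ev_eq0 : forall p, ev iota x p = 0 -> p = 0).
Hypothesis tauK : cancel tau sigma.

Lemma sigma_inj : injective sigma.
Proof.
move=> a b E; apply/eqP; rewrite -subr_eq0; apply/eqP/(endo_inj se).
by rewrite (endoB se) E subrr.
Qed.

Lemma converse_endo : @injective_endo R^c tau.
Proof.
split=> [a b|a b||a ta].
- by apply: sigma_inj; rewrite (endoB se) !tauK.
- suff : tau ((b : R) * (a : R)) = tau b * tau a by [].
  by apply: sigma_inj; rewrite (endoM se) !tauK.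
- by apply: sigma_inj; rewrite (endo1 se) tauK.
- by rewrite -[a]tauK ta (endo0 se).
Qed.

Lemma iota_shift i r : x ^+ i * iota r = iota (iter i sigma r) * x ^+ i.
Proof.
elim: i => [|i IH]; first by rewrite !expr0 mul1r mulr1.
by rewrite exprS -mulrA IH mulrA xr -mulrA.
Qed.

Lemma converse_exp i : (x : A^c) ^+ i = x ^+ i :> A.
Proof.
elim: i => // i IH; rewrite exprS exprSr -[LHS]/(((x : A^c) ^+ i : A) * x).
by rewrite IH.
Qed.

(** Over the converse ring the coefficients stand to the right of the powers of [x]; moving them
    across [x ^+ i] applies [sigma^i]. Bijectivity of this twist carries freeness and generation
    over to [A^c]. *)
Lemma ev_converse (q : {poly R^c}) n : (size q <= n)%N ->
  @ev R^c A^c (converse_fun iota) x q = \sum_(i < n) iota (iter i sigma q`_i) * x ^+ i :> A.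
Proof.
move=> sq; rewrite (@ev_coef R^c A^c (converse_fun iota) x _ _ sq); apply: eq_bigr => i _.
by rewrite -iota_shift -converse_exp.
Qed.

Theorem ore_semiprime_Goldie_converse : semiprime R^c /\ left_Goldie R^c ->
  semiprime A^c /\ left_Goldie A^c.
Proof.
have iterK i : cancel (iter i tau) (iter i sigma).
  by elim: i => // i IH r; rewrite iterSr iterS tauK IH.
apply: (@ore_semiprime_Goldie R^c A^c (converse_fun iota) x tau) => //.
- exact: converse_endo.
- by move=> r; rewrite -[LHS]/(iota r * x : A) -[RHS]/(x * iota (tau r) : A) xr tauK.
- move=> f; have [p ->] := ev_surj f.
  exists (\poly_(i < size p) (iter i tau p`_i : R^c)).
  rewrite (ev_converse (size_poly _ _)) (ev_coef _ _ (leqnn (size p))).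
  by apply: eq_bigr => i _; rewrite coef_poly ltn_ord iterK.
- move=> q; rewrite (ev_converse (leqnn _)) => E.
  have : ev iota x (\poly_(i < size q) (iter i sigma q`_i : R)) = 0.
    rewrite (ev_coef _ _ (size_poly _ _)) -[RHS]E.
    by apply: eq_bigr => i _; rewrite coef_poly ltn_ord.
  move=> /ev_eq0 E0; apply/polyP => i; rewrite coef0.
  have [iq|/leq_sizeP->//] := ltnP i (size q).
  have := congr1 (fun p : {poly R} => p`_i) E0; rewrite coef_poly iq coef0.
  exact: (endo_inj (endo_iter i se)).
Qed.

End OreConverse.

(** * Skew PBW extensions *)

Record subrng (A : nzRingType) := Subrng {
  subrng_pred :> {pred A};
  subrng_closed : subring_closed subrng_pred }.

HB.instance Definition _ (A : nzRingType) (S : subrng A) :=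
  GRing.isSubringClosed.Build A (subrng_pred S) (subrng_closed S).

Definition subrng_type (A : nzRingType) (S : subrng A) := {a : A | a \in subrng_pred S}.

HB.instance Definition _ (A : nzRingType) (S : subrng A) :=
  SubChoice.on (subrng_type S).
HB.instance Definition _ (A : nzRingType) (S : subrng A) :=
  [SubChoice_isSubNzRing of subrng_type S by <:].

Section Corestriction.
Variables (R A : nzRingType) (S : subrng A) (f : {rmorphism R -> A}).

Definition corestrict (fS : forall r, f r \in subrng_pred S) (r : R) : subrng_type S :=
  Sub (f r) (fS r).

Lemma corestrict_zmod fS : zmod_morphism (corestrict fS).
Proof. by move=> a b; apply: val_inj; rewrite rmorphB !SubK rmorphB. Qed.

Lemma corestrict_monoid fS : monoid_morphism (corestrict fS).
Proof.
by split=> [|a b]; apply: val_inj; rewrite ?rmorph1 ?rmorphM !SubK ?rmorph1 ?rmorphM.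
Qed.

HB.instance Definition _ fS := GRing.isZmodMorphism.Build R (subrng_type S)
  (corestrict fS) (corestrict_zmod fS).
HB.instance Definition _ fS := GRing.isMonoidMorphism.Build R (subrng_type S)
  (corestrict fS) (corestrict_monoid fS).

End Corestriction.

Section LeftCombinations.
Variables (R A : nzRingType) (iota : {rmorphism R -> A}) (n : nat) (x : 'I_n -> A).
Implicit Types (P : {ffun 'I_n -> nat} -> Prop) (b : A).

(** The condition on exponents is a parameter, so that [in_lower] and the whole ring are both
    instances. *)
Definition left_comb P b : Prop :=
  exists (s : seq {ffun 'I_n -> nat}) (c : {ffun 'I_n -> nat} -> R),
    (forall al, al \in s -> P al) /\ b = \sum_(al <- s) iota (c al) * monom x al.

Lemma left_comb0 P : left_comb P 0.
Proof. by exists [::], (fun=> 0); rewrite big_nil. Qed.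

Lemma left_comb_term P al r : P al -> left_comb P (iota r * monom x al).
Proof.
move=> Pal; exists [:: al], (fun=> r); rewrite big_seq1; split=> // be.
by rewrite inE => /eqP ->.
Qed.

Lemma left_combD P b b' : left_comb P b -> left_comb P b' -> left_comb P (b + b').
Proof.
move=> [s [c [Ps ->]]] [t [d [Pt ->]]].
(* Coefficients are functions of the exponent and lists may repeat, so both sums are rewritten over
   one duplicate-free list, with multiplicities absorbed into the coefficients. *)
pose T := undup (s ++ t).
have H (u : seq {ffun 'I_n -> nat}) (e : _ -> R) : {subset u <= T} ->
    \sum_(al <- u) iota (e al) * monom x al =
    \sum_(al <- T) iota (e al *+ count_mem al u) * monom x al.
  elim: u => [_|a u IH sub].
    by rewrite big_nil big1 // => al _; rewrite mulr0n rmorph0 mul0r.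
  rewrite big_cons IH; last by move=> al alu; apply: sub; rewrite inE alu orbT.
  rewrite [in RHS](eq_bigr (fun al => (if al == a then iota (e al) * monom x al else 0) +
      iota (e al *+ count_mem al u) * monom x al)).
    rewrite big_split /= [X in _ = X + _](bigD1_seq a) ?undup_uniq ?sub ?mem_head //= eqxx.
    by rewrite [X in _ = _ + X + _]big1 ?addr0 // => al /negbTE ->.
  move=> al _; rewrite /= eq_sym mulrnDr rmorphD mulrDl.
  by case: eqP => _; rewrite ?mulr1n ?mulr0n ?rmorph0 ?mul0r.
exists T, (fun al => c al *+ count_mem al s + d al *+ count_mem al t); split.
  by move=> al; rewrite mem_undup mem_cat => /orP[/Ps|/Pt].
rewrite (H s c) => [|al]; last by rewrite mem_undup mem_cat => ->.
rewrite (H t d) => [|al]; last by rewrite mem_undup mem_cat orbC => ->.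
by rewrite -big_split; apply: eq_bigr => al _; rewrite /= rmorphD mulrDl.
Qed.

Lemma left_comb_sum P (I : eqType) (s : seq I) (F : I -> A) :
  (forall i, i \in s -> left_comb P (F i)) -> left_comb P (\sum_(i <- s) F i).
Proof.
move=> HF; rewrite big_seq; apply: (big_ind (left_comb P)) => //.
  exact: left_comb0.
exact: left_combD.
Qed.

End LeftCombinations.

Lemma monom_delta (A : nzRingType) n (x : 'I_n -> A) i :
  monom x [ffun j => nat_of_bool (j == i)] = x i.
Proof.
rewrite /monom (eq_bigr (fun j => if j == i then x j else 1)); last first.
  by move=> j _; rewrite ffunE; case: eqP.
by rewrite -big_mkcond big_pred1_eq.
Qed.

Lemma monom0 (A : nzRingType) n (x : 'I_n -> A) : monom x [ffun=> 0%N] = 1.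
Proof. by rewrite /monom big1 // => j _; rewrite ffunE expr0. Qed.

Section Exponents.
Variable n : nat.
Implicit Types (al : {ffun 'I_n.+1 -> nat}) (ga : {ffun 'I_n -> nat}).

Definition exp_cons k ga : {ffun 'I_n.+1 -> nat} :=
  [ffun i => if unlift ord0 i is Some j then ga j else k].
Definition exp_tail al : {ffun 'I_n -> nat} := [ffun j => al (lift ord0 j)].

Lemma exp_cons0 k ga : exp_cons k ga ord0 = k.
Proof. by rewrite ffunE unlift_none. Qed.

Lemma exp_cons_lift k ga j : exp_cons k ga (lift ord0 j) = ga j.
Proof. by rewrite ffunE liftK. Qed.

Lemma exp_consK k ga : exp_tail (exp_cons k ga) = ga.
Proof. by apply/ffunP => j; rewrite ffunE exp_cons_lift. Qed.

Lemma monom_split (A : nzRingType) (x : 'I_n.+1 -> A) al :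
  monom x al = x ord0 ^+ al ord0 * monom (fun j => x (lift ord0 j)) (exp_tail al).
Proof.
by rewrite /monom big_ord_recl; congr (_ * _); apply: eq_bigr => j _; rewrite ffunE.
Qed.

Lemma monom_cons (A : nzRingType) (x : 'I_n.+1 -> A) k ga :
  monom x (exp_cons k ga) = x ord0 ^+ k * monom (fun j => x (lift ord0 j)) ga.
Proof. by rewrite monom_split exp_cons0 exp_consK. Qed.

End Exponents.

Section PBWVariables.
Variables (R A : nzRingType) (iota : {rmorphism R -> A}) (n : nat) (x : 'I_n -> A).
Hypothesis H : quasi_comm_skew_PBW iota x.

Lemma PBW_free_monom al r : iota r * monom x al = 0 -> r = 0.
Proof.
have [_ _ free _ _] := H => E.
by apply: (free [:: al] (fun=> r) isT _ al); rewrite ?big_seq1 ?mem_head.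
Qed.

Lemma PBW_cancel al a b : iota a * monom x al = iota b * monom x al -> a = b.
Proof.
move=> E; apply/eqP; rewrite -subr_eq0; apply/eqP/(@PBW_free_monom al).
by rewrite rmorphB mulrBl E subrr.
Qed.

(** Freeness makes the coefficient [c] with [x i * iota r = iota c * x i] unique, so any choice of
    it is a ring endomorphism; it is injective because [c] is nonzero for nonzero [r]. *)
Lemma PBW_endo i : exists sigma, injective_endo sigma /\
  forall r, x i * iota r = iota (sigma r) * x i.
Proof.
have [_ _ _ H4 _] := H.
have /choice[sigma Hs] : forall r, exists c, (r <> 0 -> c <> 0) /\ x i * iota r = iota c * x i.
  move=> r; have [->|/eqP r0] := pselect (r = 0).
    by exists 0; rewrite rmorph0 mulr0 mul0r; split.
  by have [c [/eqP c0 E]] := H4 i r r0; exists c.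
have xs r : x i * iota r = iota (sigma r) * x i by case: (Hs r).
have cancel a b : iota a * x i = iota b * x i -> a = b.
  by rewrite -(monom_delta x i); apply: PBW_cancel.
exists sigma; split=> //; split=> [a b|a b||a].
- by apply: cancel; rewrite -xs !rmorphB mulrBr mulrBl !xs.
- by apply: cancel; rewrite -xs !rmorphM mulrA xs -mulrA xs mulrA.
- by apply: cancel; rewrite -xs !rmorph1 mulr1 mul1r.
- by move=> sa; apply: contrapT => a0; case: (Hs a) => /(_ a0).
Qed.

End PBWVariables.

(** * Splitting off the first variable *)

Section FirstVariable.
Variables (R A : nzRingType) (iota : {rmorphism R -> A}) (n : nat) (x : 'I_n.+1 -> A).
Hypothesis H : quasi_comm_skew_PBW iota x.
Hypothesis dedekind : forall a b : R, a * b = 1 -> b * a = 1.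

Let x0 := x ord0.
Let x' (j : 'I_n) := x (lift ord0 j).
Local Notation ev0 := (ev iota x0).

(* Here Dedekind finiteness makes the structure constants [c_ij] units: they are
   only given to be nonzero, and comparing both orders yields a one-sided inverse. *)
Lemma PBW_swap j : exists c c', x' j * x0 = iota c * x0 * x' j /\ c * c' = 1.
Proof.
have [_ _ _ _ H5] := H.
have [c [_ Ec]] := H5 ord0 (lift ord0 j); have [c' [_ Ec']] := H5 (lift ord0 j) ord0.
exists c, c'; split=> //; apply: dedekind.
apply: (@PBW_cancel _ _ _ _ _ H (exp_cons 1 [ffun k => nat_of_bool (k == j)])).
rewrite monom_cons (monom_delta x') expr1 rmorph1 mul1r rmorphM -mulrA (mulrA (iota c)).
by rewrite -Ec mulrA -Ec'.
Qed.

Lemma PBW_swap_exp j k : exists u v, x' j * x0 ^+ k = iota u * x0 ^+ k * x' j /\ u * v = 1.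
Proof.
have [sigma [se xs]] := PBW_endo H ord0.
have [c [c' [Ec cc]]] := PBW_swap j.
elim: k => [|k [u [v [E uv]]]]; first by exists 1, 1; rewrite rmorph1 expr0 !mulr1 mul1r.
exists (u * iter k sigma c), (iter k sigma c' * v); split.
  rewrite exprSr mulrA E -(mulrA _ (x' j)) Ec !mulrA rmorphM -(mulrA _ _ (iota c)).
  by rewrite (iota_shift xs) !mulrA.
have sk := endo_iter k se.
by rewrite mulrA -(mulrA u) -(endoM sk) cc (endo1 sk) mulr1.
Qed.

Lemma ev_free (s : seq {ffun 'I_n -> nat}) (p : {ffun 'I_n -> nat} -> {poly R}) :
  uniq s -> \sum_(ga <- s) ev0 (p ga) * monom x' ga = 0 ->
  forall ga, ga \in s -> p ga = 0.
Proof.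
move=> us E ga gas; have [_ _ free _ _] := H.
pose N := (\max_(be <- s) size (p be))%N.
have sN be : be \in s -> (size (p be) <= N)%N by move=> bes; apply: leq_bigmax_seq.
have Hc : \sum_(al <- [seq exp_cons k be | be <- s, k <- seq.iota 0 N])
    iota (p (exp_tail al))`_(al ord0) * monom x al = 0.
  rewrite big_allpairs_dep -[RHS]E big_seq [RHS]big_seq; apply: eq_bigr => be /sN sb.
  rewrite (ev_coef _ _ sb) big_distrl /= -(big_mkord xpredT
    (fun k => iota (p be)`_k * x0 ^+ k * monom x' be)) /index_iota subn0.
  by apply: eq_bigr => k _; rewrite exp_cons0 exp_consK monom_cons mulrA.
apply/polyP => k; rewrite coef0.
have [kN|Nk] := ltnP k N; last by apply/leq_sizeP: Nk; apply: sN.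
have := free _ _ _ Hc (exp_cons k ga); rewrite exp_cons0 exp_consK; apply.
  apply: allpairs_uniq => //; first exact: iota_uniq.
  move=> [a i] [b j] _ _ /= Eab; congr pair.
    by rewrite -(exp_consK i a) Eab exp_consK.
  by rewrite -(exp_cons0 i a) Eab exp_cons0.
by apply/allpairsP; exists (ga, k); rewrite mem_iota.
Qed.

Lemma ev0_eq0 p : ev0 p = 0 -> p = 0.
Proof.
move=> E; apply: (@ev_free [:: [ffun=> 0%N]] (fun=> p)) (mem_head _ _) => //.
by rewrite big_seq1 E mul0r.
Qed.

Definition first_pred : {pred A} := fun a => `[< exists p, a = ev0 p >].

Lemma first_predP a : reflect (exists p, a = ev0 p) (a \in first_pred).
Proof. exact: asboolP. Qed.

Lemma first_closed : subring_closed first_pred.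
Proof.
have [sigma [se xs]] := PBW_endo H ord0.
split.
- by apply/first_predP; exists 1; rewrite /ev rmorph1 hornerC.
- move=> _ _ /first_predP[p ->] /first_predP[q ->]; apply/first_predP.
  by exists (p - q); rewrite evB.
- move=> _ _ /first_predP[p ->] /first_predP[q ->]; apply/first_predP.
  have [h [-> _ _]] := ev_mul_lead se xs (leqSpred (size p)) (leqSpred (size q)).
  by exists h.
Qed.

Definition first_subrng := Subrng first_closed.
Local Notation B := (subrng_type first_subrng).
Let j : {rmorphism B -> A} := \val.

Lemma ev_first p : exists b : B, val b = ev0 p.
Proof.
have pB : ev0 p \in subrng_pred first_subrng by apply/first_predP; exists p.
by exists (Sub (ev0 p) pB); rewrite SubK.
Qed.

Lemma first_ev (b : B) : exists p, val b = ev0 p.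
Proof. exact/first_predP/(valP b). Qed.

Lemma first_iota r : iota r \in subrng_pred first_subrng.
Proof. by apply/first_predP; exists r%:P; rewrite /ev map_polyC hornerC. Qed.

Definition first_base : {rmorphism R -> B} := corestrict first_iota.

(** The condition restricts only the tail of the exponent, so all powers of the first variable can
    be absorbed into coefficients from the subring it generates over [R]. *)
Lemma left_comb_first P P' b : (forall al, P al <-> P' (exp_tail al)) ->
  left_comb iota x P b <-> left_comb j x' P' b.
Proof.
move=> PP'; split=> -[s [c [Hs ->]]]; apply: left_comb_sum => al /Hs Pal.
  have [d Ed] := ev_first (c al *: 'X^(al ord0)).
  have -> : iota (c al) * monom x al = j d * monom x' (exp_tail al).
    by rewrite [j d]Ed evZ /ev map_polyXn hornerXn monom_split mulrA.
  exact/left_comb_term/PP'.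
have [p Ep] := first_ev (c al).
rewrite [j _]Ep (ev_coef _ _ (leqnn _)) big_distrl; apply: left_comb_sum => k _ /=.
rewrite -mulrA -monom_cons; apply: left_comb_term; apply/PP'.
by rewrite exp_consK.
Qed.

Lemma lower_first i b :
  in_lower iota x (lift ord0 i) b <-> in_lower j x' i b.
Proof.
apply: left_comb_first => al; split=> Hal k.
  by move=> ik; rewrite ffunE; apply: Hal; rewrite /= /bump !leq0n ltnS.
case: (unliftP ord0 k) => [k' ->|-> //]; rewrite /= /bump !leq0n ltnS => ik.
by have := Hal k' ik; rewrite ffunE.
Qed.

Lemma first_PBW : quasi_comm_skew_PBW j x'.
Proof.
have [inj cov free H4 H5] := H; split.
- exact: val_inj.
- move=> a; have [s [c Ea]] := cov a.
  have : left_comb iota x (fun=> True) a by exists s, c.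
  move=> /(@left_comb_first _ (fun=> True))[|s' [c' [_ ->]]] //.
  by exists s', c'.
- move=> s c us E ga gas.
  have /choice[p Ep] : forall be, exists p, j (c be) = ev0 p.
    by move=> be; apply: first_ev.
  apply: val_inj; rewrite -[LHS]/(j (c ga)) Ep (@ev_free s p) ?ev0 ?raddf0 //.
    by rewrite /ev rmorph0 horner0.
  by rewrite -[RHS]E; apply: eq_bigr => be _; rewrite Ep.
- move=> i b b0; have [p Ep] := first_ev b.
  have [sigma [se xs]] := PBW_endo H (lift ord0 i).
  have /choice[u Hu] := PBW_swap_exp i.
  (* Moving [x' i] past each term [p_k * x0 ^+ k] produces the coefficient [sigma p_k * u k]. Its
     vanishing forces [p_k = 0] because [u k] has a right inverse; a [u k] that is merely nonzero
     could be a zero divisor. *)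
  have [b' Eb'] := ev_first (\poly_(k < size p) (sigma p`_k * u k)).
  exists b'; split.
    apply/eqP => b'0; case/eqP: b0; apply: val_inj; rewrite Ep.
    suff -> : p = 0 by rewrite /ev rmorph0 horner0 raddf0.
    have := Eb'; rewrite b'0 raddf0 => /esym/ev0_eq0 E0.
    apply/polyP => k; rewrite coef0.
    have [kp|/leq_sizeP->//] := ltnP k (size p).
    have := congr1 (fun q : {poly R} => q`_k) E0; rewrite coef_poly kp coef0 => Ek.
    have [v [_ uv]] := Hu k; apply: (endo_inj se).
    by rewrite -[sigma _]mulr1 -uv mulrA Ek mul0r.
  rewrite -[LHS]/(x' i * j b) [j b]Ep [j b']Eb'.
  rewrite (ev_coef _ _ (leqnn _)) (ev_coef _ _ (size_poly _ _)) big_distrr big_distrl /=.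
  apply: eq_bigr => k _; rewrite coef_poly ltn_ord mulrA xs -mulrA.
  by have [v [-> _]] := Hu k; rewrite rmorphM !mulrA.
- move=> i k; have [c [/eqP c0 E]] := H5 (lift ord0 i) (lift ord0 k).
  exists (first_base c); split; last by rewrite E.
  apply/eqP => fc; apply: c0; apply: inj; rewrite rmorph0.
  by have := congr1 j fc; rewrite rmorph0.
Qed.

Definition first_var : B :=
  Sub x0 (introT (first_predP x0) (ex_intro _ 'X
    (esym (etrans (congr1 (fun q => q.[x0]) (map_polyX iota)) (hornerX x0))))).

Lemma val_ev_first p : j (ev first_base first_var p) = ev0 p.
Proof.
rewrite (ev_coef _ _ (leqnn _)) [RHS](ev_coef _ _ (leqnn _)) rmorph_sum.
by apply: eq_bigr => k _; rewrite rmorphM rmorphXn.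
Qed.

End FirstVariable.

(** Surjectivity of every [sigma_i], in the form that is carried through the induction; injectivity
    comes from [PBW_endo]. *)
Definition lower_surjective (R A : nzRingType) (iota : {rmorphism R -> A})
    n (x : 'I_n -> A) : Prop :=
  forall i b', in_lower iota x i b' ->
    exists b, in_lower iota x i b /\ x i * b = b' * x i.

Lemma PBW_first_variable (R A : nzRingType) (iota : {rmorphism R -> A}) n
    (x : 'I_n.+1 -> A) :
  quasi_comm_skew_PBW iota x -> (forall a b : R, a * b = 1 -> b * a = 1) ->
  exists (B : nzRingType) (i0 : {rmorphism R -> B}) (j : {rmorphism B -> A})
      (y : B) (sigma : R -> R),
    [/\ injective_endo sigma, forall r, y * i0 r = i0 (sigma r) * y,
        forall f, exists p, f = ev i0 y p & forall p, ev i0 y p = 0 -> p = 0] /\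
    quasi_comm_skew_PBW j (fun i => x (lift ord0 i)) /\
    (lower_surjective iota x -> (exists tau, cancel tau sigma) /\
       lower_surjective j (fun i => x (lift ord0 i))).
Proof.
move=> H ded; have [sigma [se xs]] := PBW_endo H ord0.
pose j : {rmorphism subrng_type (first_subrng H) -> A} := \val.
exists (subrng_type (first_subrng H)), (first_base H), j, (first_var H), sigma.
split; first split=> //.
- by move=> r; apply: val_inj; apply: xs.
- move=> f; have [p Ep] := first_ev f; exists p; apply: val_inj.
  by rewrite Ep -(val_ev_first H).
- move=> p E; apply: (ev0_eq0 H); rewrite -(val_ev_first H) E; exact: raddf0.
split; first exact: first_PBW.
move=> surj; split.
  (* Below the first variable the lower ring is [R] itself: only the zero exponent occurs, so the
     preimage found in it is the image of a sum of coefficients. *)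
  have /choice[tau Ht] : forall r, exists t, sigma t = r.
    move=> r; have [|b [[s [c [Hs Eb]]] E]] := surj ord0 (iota r).
      exists [:: [ffun=> 0%N]], (fun=> r); rewrite big_seq1 monom0 mulr1.
      by split=> // al; rewrite inE => /eqP -> k _; rewrite ffunE.
    exists (\sum_(al <- s) c al); apply: (PBW_cancel H (al := [ffun k => nat_of_bool (k == ord0)])).
    rewrite monom_delta -xs -E Eb rmorph_sum big_seq [in RHS]big_seq.
    congr (_ * _); apply: eq_bigr => al /Hs al0.
    by rewrite /monom big1 ?mulr1 // => k _; rewrite al0.
  by exists tau.
move=> i b' /(lower_first H)/surj[b [/(lower_first H) Hb E]].
by exists b.
Qed.

(** * Induction on the number of variables *)

Lemma PBW0_surjective (R A : nzRingType) (iota : {rmorphism R -> A}) (x : 'I_0 -> A) :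
  quasi_comm_skew_PBW iota x -> forall a, exists r, a = iota r.
Proof.
move=> [_ cov _ _ _] a; have [s [c ->]] := cov a; exists (\sum_(al <- s) c al).
by rewrite rmorph_sum; apply: eq_bigr => al _; rewrite /monom big_ord0 mulr1.
Qed.

Lemma PBW_semiprime_Goldie n (R A : nzRingType) (iota : {rmorphism R -> A})
    (x : 'I_n -> A) : quasi_comm_skew_PBW iota x ->
  semiprime R /\ left_Goldie R -> semiprime A /\ left_Goldie A.
Proof.
elim: n R A iota x => [|n IH] R A iota x H gR.
  apply: (semiprime_Goldie_iso (f := iota)) gR; first by case: H.
  exact: PBW0_surjective H.
have [sR [accR /finite_left_udimP finR]] := gR.
have [B [i0 [j [y [sigma [[se xs es e0] [HB _]]]]]]] :=
  PBW_first_variable H (dedekind_finite sR accR finR).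
exact: IH HB (ore_semiprime_Goldie se xs es e0 gR).
Qed.

Lemma PBW_semiprime_Goldie_converse n (R A : nzRingType) (iota : {rmorphism R -> A})
    (x : 'I_n -> A) : quasi_comm_skew_PBW iota x -> lower_surjective iota x ->
  semiprime R^c /\ left_Goldie R^c -> semiprime A^c /\ left_Goldie A^c.
Proof.
elim: n R A iota x => [|n IH] R A iota x H surj gR.
  apply: (@semiprime_Goldie_iso R^c A^c (converse_fun iota)) gR; first by case: H.
  exact: PBW0_surjective H.
have [sR [accR /finite_left_udimP finR]] := gR.
have ded (a b : R) : a * b = 1 -> b * a = 1.
  exact: (@dedekind_finite R^c sR accR finR b a).
have [B [i0 [j [y [sigma [[se xs es e0] [HB Hsurj]]]]]]] := PBW_first_variable H ded.
have [[tau tauK] surjB] := Hsurj surj.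
exact: IH HB surjB (ore_semiprime_Goldie_converse se xs es e0 tauK gR).
Qed.

Theorem theorem4p4 (R A : nzRingType) (iota : {rmorphism R -> A})
    (n : nat) (x : 'I_n -> A) :
  quasi_comm_skew_PBW iota x ->
  ((semiprime R /\ left_Goldie R) ->
     [/\ semiprime A, left_Goldie A & Ql_exists_semisimple A]) /\
  ((semiprime R /\ right_Goldie R) -> all_sigma_bijective iota x ->
     [/\ semiprime A, right_Goldie A & Qr_exists_semisimple A]).
Proof.
move=> H; split=> [gR|[sR gR] bij].
  have [sA gA] := PBW_semiprime_Goldie H gR.
  by split=> //; apply: left_Goldie_quotient.
have surj : lower_surjective iota x.
  by move=> i b' /(proj2 (bij i))[b [Hb E _]]; exists b.
have gRc : semiprime R^c /\ left_Goldie R^c by split=> //; apply/semiprime_converse.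
have [sA gA] := PBW_semiprime_Goldie_converse H surj gRc.
by split=> //; [apply/semiprime_converse|apply: right_Goldie_quotient].
Qed.
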